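(* Let $\vartheta$ be the set-valued map of a primitive random substitution on a finite alphabet $\mathcal{A}=\{a_1,\dots,a_d\}$, and regard the non-degenerate probability data $\mathbf{P}$ for $\vartheta$ (all probabilities strictly positive) as vectors in $\mathbb{R}^r$ with the Euclidean topology, where $r=\sum_{i=1}^d\#\vartheta(a_i)$. Then the map $\mathbf{P}\mapsto h(\mu_{\mathbf{P}})$, assigning to $\mathbf{P}$ the entropy of the frequency measure of $\vartheta_{\mathbf{P}}=(\vartheta,\mathbf{P})$, is continuous on the set of all non-degenerate $\mathbf{P}$.
   Context: $\mathbb{N}=\{1,2,\dots\}$. $\mathcal{A}^+$ is the set of non-empty finite words over $\mathcal{A}$, $|u|$ the length of a word $u$, and $|u|_v$ the number of (possibly overlapping) occurrences of $v$ as a subword of $u$. A random substitution $\vartheta_{\mathbf{P}}=(\vartheta,\mathbf{P})$ is a map $\vartheta$ assigning to each letter $a_i$ a non-empty finite set $\vartheta(a_i)=\{s^{(i,1)},\dots,s^{(i,r_i)}\}\subset\mathcal{A}^+$ of $r_i$ distinct words, together with probability vectors $\mathbf{p}_i=(p_{i,1},\dots,p_{i,r_i})$ with all $p_{i,j}>0$ and $\sum_j p_{i,j}=1$; $\vartheta_{\mathbf{P}}(a_i)$ is the random word equal to $s^{(i,j)}$ with probability $p_{i,j}$. It is extended to words by applying it independently to each letter and concatenating; $(\vartheta_{\mathbf{P}}^n(u))_{n}$ is the Markov chain obtained by iterating this with fresh independent choices at each step, starting from $u$. $\mathbb{P},\mathbb{E}$ denote the corresponding probability and expectation, and $\vartheta^n(u)=\{v:\mathbb{P}[\vartheta_{\mathbf{P}}^n(u)=v]>0\}$.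 The substitution matrix is $M_{i,j}=\mathbb{E}[|\vartheta_{\mathbf{P}}(a_j)|_{a_i}]$. $\vartheta_{\mathbf{P}}$ is primitive if $M$ is primitive and its Perron--Frobenius eigenvalue satisfies $\lambda>1$; this property does not depend on the choice of non-degenerate $\mathbf{P}$. The language $\mathcal{L}_\vartheta$ is the set of words occurring as subwords of some word in $\vartheta^k(a)$, $a\in\mathcal{A}$, $k\in\mathbb{N}$; $\mathcal{L}_\vartheta^n=\mathcal{L}_\vartheta\cap\mathcal{A}^n$. $X_\vartheta\subset\mathcal{A}^{\mathbb{Z}}$ is the set of bi-infinite sequences all of whose finite subwords lie in $\mathcal{L}_\vartheta$, with left shift $S$. For $v\in\mathcal{L}_\vartheta$, $[v]=\{x\in X_\vartheta: x_0\cdots x_{|v|-1}=v\}$. The frequency measure $\mu_{\mathbf{P}}$ is the unique shift-invariant Borel probability measure on $X_\vartheta$ with $\mu_{\mathbf{P}}([v])=\lim_{k\to\infty}\mathbb{E}[|\vartheta_{\mathbf{P}}^k(a)|_v]/\mathbb{E}[|\vartheta_{\mathbf{P}}^k(a)|]$ for all $v\in\mathcal{L}_\vartheta$ (the limit exists and is independent of $a$; $\mu_{\mathbf{P}}$ is ergodic). Its entropy is $h(\mu_{\mathbf{P}})=\lim_{n\to\infty}\frac1n\sum_{u\in\mathcal{L}_\vartheta^n}-\mu_{\mathbf{P}}([u])\log\mu_{\mathbf{P}}([u])$. *)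

(* Defs.v *)
From HB Require Import structures.
From mathcomp Require Import all_boot all_order all_algebra finmap.
From mathcomp Require Import complex.
From mathcomp Require Import all_classical all_reals all_analysis.

Set Implicit Arguments.
Unset Strict Implicit.
Unset Printing Implicit Defensive.

Import Order.TTheory GRing.Theory Num.Theory numFieldNormedType.Exports.

Local Open Scope fset_scope.
Local Open Scope classical_set_scope.
Local Open Scope ring_scope.

(* The alphabet is 'I_d.+1, i.e. it has d + 1 letters and is non-empty. *)
Notation word d := (seq 'I_d.+1).

Definition is_subst d (theta : 'I_d.+1 -> {fset word d}) : Prop :=
  forall a, theta a != fset0 /\ [::] \notin theta a.

(* r = \sum_i #theta(a_i); a point of R^r is split into consecutive
   blocks p_i, one per letter, by submxrow. *)
Definition nparams d (theta : 'I_d.+1 -> {fset word d}) : nat :=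
  (\sum_(a < d.+1) #|{: theta a}|)%N.

Section RandomSubstitution.
Variables (R : realType) (d : nat) (theta : 'I_d.+1 -> {fset word d}).

Definition param (P : 'rV[R]_(nparams theta)) (a : 'I_d.+1) (s : theta a) : R :=
  (submxrow P a : 'rV[R]_#|{: theta a}|) 0 (enum_rank s).

Definition nondegenerate_data : set 'rV[R]_(nparams theta) :=
  [set P | forall a, (forall s : theta a, 0 < param P s) /\
                     \sum_(s : theta a) param P s = 1].

Variable P : 'rV[R]_(nparams theta).

Definition letter_prob (a : 'I_d.+1) (w : word d) : R :=
  \sum_(s : theta a | val s == w) param P s.

(* Letters are substituted independently and the results concatenated, so the
   law of the image of a :: u is the convolution of the laws of the images of
   a and u: sum over the ways of cutting v in two. *)
Fixpoint step_prob (u v : word d) : R :=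
  if u is a :: u' then
    \sum_(i < (size v).+1) letter_prob a (take i v) * step_prob u' (drop i v)
  else (v == [::])%:R.

(* n-step transition probabilities P[theta_P^n(u) = v]; for non-degenerate P
   only finitely many w contribute. *)
Fixpoint iter_prob (n : nat) (u v : word d) : R :=
  if n is m.+1 then
    \sum_(w \in [set: word d]) iter_prob m u w * step_prob w v
  else (v == u)%:R.

Definition subst_expectation (n : nat) (u : word d) (f : word d -> R) : R :=
  \sum_(v \in [set: word d]) iter_prob n u v * f v.

Definition realisations (n : nat) (u : word d) : set (word d) :=
  [set v | 0 < iter_prob n u v].

(* |u|_v, for non-empty v *)
Definition occ (v u : word d) : nat :=
  count (fun i => prefix v (drop i u)) (iota 0 (size u)).

Definition subst_matrix : 'M[R]_d.+1 :=
  \matrix_(i, j) subst_expectation 1 [:: j] (fun w => (occ [:: i] w)%:R).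

Definition language : set (word d) :=
  [set v | v != [::] /\
    exists a k w, [/\ (0 < k)%N, realisations k [:: a] w & infix v w]].

End RandomSubstitution.

Definition primitive_mx (R : realType) n (M : 'M[R]_n.+1) : Prop :=
  (forall i j, 0 <= M i j) /\
  exists k, (0 < k)%N /\ forall i j, 0 < (M ^+ k) i j.

(* The Perron-Frobenius eigenvalue: a real eigenvalue that is maximal in
   modulus among the complex ones. *)
Definition is_PF_eigenvalue (R : realType) n (M : 'M[R]_n.+1) (lambda : R) :
    Prop :=
  eigenvalue M lambda /\
  forall z : R[i], eigenvalue (map_mx (real_complex R) M) z ->
    `|z| <= real_complex R lambda.

Definition primitive_subst (R : realType) d
    (theta : 'I_d.+1 -> {fset word d}) (P : 'rV[R]_(nparams theta)) : Prop :=
  primitive_mx (subst_matrix P) /\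
  exists lambda, is_PF_eigenvalue (subst_matrix P) lambda /\ 1 < lambda.

(* A^Z with the product of the discrete topologies and its Borel
   sigma-algebra. *)
Definition full_shift_topology (d : nat) :=
  prod_topology (fun _ : int => discrete_topology 'I_d.+1).

HB.instance Definition _ d := isPointed.Build 'I_d.+1 ord0.

Notation full_shift d :=
  (g_sigma_algebraType (@open (full_shift_topology d))).

Definition left_shift d (x : int -> 'I_d.+1) : int -> 'I_d.+1 := fun i => x (i + 1).

(* x_i ... x_(i + n - 1) *)
Definition window d (x : int -> 'I_d.+1) (i : int) (n : nat) : word d :=
  [seq x (i + Posz k) | k <- iota 0 n].

Section Entropy.
Variables (R : realType) (d : nat) (theta : 'I_d.+1 -> {fset word d}).
Variable P : 'rV[R]_(nparams theta).

Definition subshift : set (full_shift d) :=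
  [set x | forall i n, (0 < n)%N -> language P (window x i n)].

Definition cylinder (v : word d) : set (full_shift d) :=
  [set x | subshift x /\ window x 0 (size v) = v].

(* Borel probability measures on the closed set X_theta are identified with
   Borel probability measures on A^Z giving it mass 1. The cylinder values
   determine the measure, so at most one mu satisfies this for a given P. *)
Definition is_frequency_measure (mu : probability (full_shift d) R) : Prop :=
  [/\ mu subshift = 1%E,
      forall B : set (full_shift d), measurable B ->
        mu ((@left_shift d : full_shift d -> full_shift d) @^-1` B) = mu B
    & forall v a, language P v ->
        (fun k => subst_expectation P k [:: a] (fun w => (occ v w)%:R) /
                  subst_expectation P k [:: a] (fun w => (size w)%:R))
          @ \oo --> fine (mu (cylinder v))].

(* ln 0 = 0, so the convention 0 log 0 = 0 holds. *)
Definition block_entropy (mu : probability (full_shift d) R) (n : nat) : R :=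
  \sum_(u : n.-tuple 'I_d.+1 | `[< language P u >])
    - (fine (mu (cylinder u)) * ln (fine (mu (cylinder u)))).

Definition entropy (mu : probability (full_shift d) R) : R :=
  limn (fun n => block_entropy mu n / n%:R).

End Entropy.

(* Main.v *)
Require Import Defs.
From HB Require Import structures.
From mathcomp Require Import all_boot all_order all_algebra finmap.
From mathcomp Require Import all_classical all_reals all_analysis.
From mathcomp Require Import ring lra zify.

(** Write lam for the growth rate of the substitution, r_a for the frequency of
    the letter a, K for the maximal length of an image, H_m(a) for the entropy of
    the random word obtained from a in m steps, and
    L_m = lam^-m * sum_a r_a H_m(a). The theorem follows from three facts about
    the entropy h of the frequency measure, for one fixed choice P of the
    probabilities.

    - h is both the limit of the block entropies per letter and the limit of L_m.
      Both comparisons use the inequality of Gibbs, that an entropy is at most a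
      cross entropy. The law of a long iterate is compared with the product of
      the frequencies of its consecutive n-blocks, averaged over the n ways to
      start cutting: this bounds L_m by the n-block entropy divided by n, up to
      a vanishing error ([mean_entropy_le]). The frequencies of n-words are
      compared with the law of a window at a random place in the image of
      independent uniform letters under m steps: this bounds the n-block entropy
      ([block_entropy_le]).

    - The second comparison gives h <= L_m + lam^-m * ln #A for every m. The
      right-hand side is continuous in P and tends to h, so h is upper
      semicontinuous.

    - Let X be an iterate, A its image under m further steps and B the image of A
      under one more step. The entropy of the random choices leading from A to B,
      conditioned on B, measures how badly B can be desubstituted. Up to the cost
      of marking where the images of the letters of X begin, this quantity is
      subadditive under concatenation, so its growth rate is bounded above by
      quantities which are continuous in P. By the chain rule it equals an
      explicit term plus H(A) - H(B), and the explicit term cancels from both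
      sides; [entropy_increment_le] is the resulting inequality. Dividing by
      the length it becomes
        (lam - 1) h >= lam L_(m+1) - L_m - lam^-m (ln #A + (m+1) ln K),
      see [entropy_limit_ge]. The right-hand side is continuous in P and tends to
      (lam - 1) h, so h is lower semicontinuous. This holds although the images
      of a letter may have different lengths, so that the positions of the cuts
      carry information.

    It remains to see that lam and r depend continuously on P
    ([letter_freq_cvg]) and that lam > 1 for all P ([growth_rate_gt1]). *)

Set Implicit Arguments.
Unset Strict Implicit.
Unset Printing Implicit Defensive.
Import Order.TTheory GRing.Theory Num.Theory numFieldNormedType.Exports.
Local Open Scope classical_set_scope.
Local Open Scope ring_scope.

(** * Enumerating words *)

Section Words.
Variable d : nat.
Implicit Types (w v : word d) (n m : nat).

Fixpoint words n : seq (word d) :=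
  if n is m.+1 then [seq c :: w | c <- enum 'I_d.+1, w <- words m]
  else [:: [::]].

Definition words_upto n : seq (word d) := flatten [seq words l | l <- iota 0 n.+1].

Lemma mem_words n w : (w \in words n) = (size w == n).
Proof.
elim: n w => [|n IH] [|c w] //=.
  by apply/negbTE/negP => /allpairsP[[a b] /= []].
rewrite eqSS -IH; apply/allpairsP/idP => [[[a b] /= [_ bw [_ ->]]] //|cw].
by exists (c, w); rewrite mem_enum.
Qed.

Lemma words_uniq n : uniq (words n).
Proof.
elim: n => //= n IH; apply: allpairs_uniq => //; first exact: enum_uniq.
by move=> [a b] [a' b'] /= _ _ [-> ->].
Qed.

Lemma mem_words_upto n w : (w \in words_upto n) = (size w <= n)%N.
Proof.
rewrite -ltnS; apply/flatten_mapP/idP => [[l]|wn].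
  by rewrite mem_iota mem_words => /= ln /eqP ->.
by exists (size w); rewrite ?mem_iota ?mem_words.
Qed.

Lemma words_upto_uniq n : uniq (words_upto n).
Proof.
rewrite /words_upto; have := iota_uniq 0 n.+1.
elim: (iota 0 n.+1) => //= l s IH /andP[ls us]; rewrite cat_uniq words_uniq IH //.
rewrite andbT; apply/hasPn => w /flatten_mapP[l' l's]; rewrite !mem_words => /eqP wl.
by apply/negP => /eqP ll'; move: ls; rewrite -ll' wl l's.
Qed.

Lemma big_words0 (V : nmodType) (F : word d -> V) :
  \sum_(w <- words 0) F w = F [::].
Proof. by rewrite big_seq1. Qed.

Lemma big_wordsS (V : nmodType) n (F : word d -> V) :
  \sum_(w <- words n.+1) F w = \sum_c \sum_(w <- words n) F (c :: w).
Proof. by rewrite big_allpairs_dep big_enum. Qed.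

Lemma big_words_upto (V : nmodType) n (F : word d -> V) :
  \sum_(w <- words_upto n) F w = \sum_(0 <= l < n.+1) \sum_(w <- words l) F w.
Proof. by rewrite big_flatten big_map /index_iota subn0. Qed.

Lemma big_words_uptoS (V : nmodType) n (F : word d -> V) :
  \sum_(w <- words_upto n.+1) F w =
  F [::] + \sum_c \sum_(w <- words_upto n) F (c :: w).
Proof.
rewrite big_words_upto big_nat_recl // big_words0; congr (_ + _).
under eq_bigr do rewrite big_wordsS.
by rewrite exchange_big /=; apply: eq_bigr => c _; rewrite big_words_upto.
Qed.

Lemma big_words_cat (V : nmodType) n m (F : word d -> V) :
  \sum_(w <- words (n + m)) F w =
  \sum_(x <- words n) \sum_(y <- words m) F (x ++ y).
Proof.
elim: n F => [|n IH] F; first by rewrite big_words0.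
by rewrite addSn !big_wordsS; apply: eq_bigr => c _; rewrite IH.
Qed.

Lemma big_words_tuple (V : nmodType) n (F : word d -> V) :
  \sum_(u : n.-tuple 'I_d.+1) F u = \sum_(w <- words n) F w.
Proof.
rewrite -big_enum /= -(big_map val xpredT F) /=; apply: perm_big; apply: uniq_perm.
- by rewrite map_inj_uniq ?enum_uniq //; exact: val_inj.
- exact: words_uniq.
move=> w; rewrite mem_words; apply/mapP/eqP => [[u _ ->]|wn]; first by rewrite size_tuple.
by exists (tcast wn (in_tuple w)); rewrite ?mem_enum ?val_tcast.
Qed.

Lemma big_words_pick (R : pzRingType) n (F : word d -> R) v : size v = n ->
  \sum_(w <- words n) (w == v)%:R * F w = F v.
Proof.
move=> vn; rewrite (bigD1_seq v) ?mem_words ?vn ?words_uniq //= eqxx mul1r.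
by rewrite big1 ?addr0 // => w /negbTE ->; rewrite mul0r.
Qed.

Lemma big_words_upto_pick (R : pzRingType) n (F : word d -> R) v : (size v <= n)%N ->
  \sum_(w <- words_upto n) (v == w)%:R * F w = F v.
Proof.
move=> vn; rewrite (bigD1_seq v) ?mem_words_upto ?words_upto_uniq //= eqxx mul1r.
by rewrite big1 ?addr0 // => w; rewrite eq_sym => /negbTE ->; rewrite mul0r.
Qed.

Lemma size_words n : size (words n) = (d.+1 ^ n)%N.
Proof. by elim: n => //= n IH; rewrite size_allpairs size_enum_ord IH expnS. Qed.

Lemma big_words_const (R : pzRingType) n (x : R) :
  \sum_(w <- words n) x = d.+1%:R ^+ n * x.
Proof. by rewrite big_const_seq count_predT size_words iter_addr_0 -natrX mulr_natl. Qed.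

Lemma prefix_eq_take (u w : word d) :
  prefix u w = (u == take (size u) w) .
Proof. by rewrite prefixE eq_sym. Qed.

(** A word has at most one prefix of each length. *)
Lemma sum_prefix_le1 (R : numDomainType) n w :
  \sum_(u <- words n) (prefix u w)%:R <= 1 :> R.
Proof.
have [nw|wn] := leqP n (size w).
  rewrite -[leRHS](@big_words_pick R n (fun=> 1) (take n w)); last by rewrite size_takel.
  rewrite big_seq [leRHS]big_seq; apply: ler_sum => u; rewrite mem_words => /eqP un.
  by rewrite mulr1 prefix_eq_take un.
rewrite big_seq big1 ?ler01 // => u; rewrite mem_words => /eqP un.
case: prefixP => // -[s ws]; move: wn.
by rewrite ws size_cat un ltnNge leq_addr.
Qed.

End Words.

(** * The law of the iterated random substitution *)

Section Law.
Variables (R : realType) (d : nat) (theta : 'I_d.+1 -> {fset word d}).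
Implicit Types (u v w : word d) (n m k : nat) (f g : word d -> R).

Definition maxlen : nat := \max_(a < d.+1) \max_(s : theta a) size (val s).

Lemma size_le_maxlen a (s : theta a) : (size (val s) <= maxlen)%N.
Proof.
by apply: leq_trans (leq_bigmax a); exact: (leq_bigmax (F := fun s : theta a => size (val s))).
Qed.

Variable P : 'rV[R]_(nparams theta).

Fixpoint step_expect u f : R :=
  if u is a :: u' then
    \sum_(s : theta a) param P s * step_expect u' (fun v => f (val s ++ v))
  else f [::].

(** Laws of random words are handled through their expectation functionals: these
    are finite recursions, whereas the transition probabilities are sums over all
    words. *)
Fixpoint expect n u f : R :=
  if n is m.+1 then expect m u (step_expect^~ f) else f u.

Definition pr n u v : R := expect n u (fun w => (w == v)%:R).

Lemma eq_expect n u f g : f =1 g -> expect n u f = expect n u g.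
Proof. by move=> /funext ->. Qed.

Lemma step_expectD u f g :
  step_expect u (fun w => f w + g w) = step_expect u f + step_expect u g.
Proof.
elim: u f g => //= a u IH f g; rewrite -big_split; apply: eq_bigr => s _ /=.
by rewrite -mulrDr -IH.
Qed.

Lemma step_expectZ u c f : step_expect u (fun w => c * f w) = c * step_expect u f.
Proof.
elim: u f => //= a u IH f; rewrite big_distrr; apply: eq_bigr => s _ /=.
by rewrite mulrCA -IH.
Qed.

Lemma expectD n u f g : expect n u (fun w => f w + g w) = expect n u f + expect n u g.
Proof.
elim: n f g => //= n IH f g; rewrite -IH; apply: eq_expect => w.
exact: step_expectD.
Qed.

Lemma expectZ n u c f : expect n u (fun w => c * f w) = c * expect n u f.
Proof.
elim: n f => //= n IH f; rewrite -IH; apply: eq_expect => w.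
exact: step_expectZ.
Qed.

Lemma expectZr n u c f : expect n u (fun w => f w * c) = expect n u f * c.
Proof. by rewrite mulrC -expectZ; apply: eq_expect => w; rewrite mulrC. Qed.

Lemma expectN n u f : expect n u (fun w => - f w) = - expect n u f.
Proof. by rewrite -mulN1r -expectZ; apply: eq_expect => w; rewrite mulN1r. Qed.

Lemma expectB n u f g : expect n u (fun w => f w - g w) = expect n u f - expect n u g.
Proof. by rewrite expectD expectN. Qed.

Lemma expect0 n u : expect n u (fun=> 0) = 0.
Proof.
rewrite -[RHS](mul0r (expect n u (fun=> 0))) -expectZ.
by apply: eq_expect => w; rewrite mul0r.
Qed.

Lemma expect_sum n u (I : Type) (r : seq I) (F : I -> word d -> R) :
  expect n u (fun w => \sum_(i <- r) F i w) = \sum_(i <- r) expect n u (F i).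
Proof.
elim: r => [|i r IH].
  by rewrite big_nil -[RHS](expect0 n u); apply: eq_expect => w; rewrite big_nil.
rewrite big_cons -IH -expectD; apply: eq_expect => w; exact: big_cons.
Qed.

Lemma expect_comp k m u f : expect (k + m) u f = expect k u (fun w => expect m w f).
Proof. by elim: m f => [|m IH] f; rewrite ?addn0 // addnS /= IH. Qed.

Lemma expect_nil n f : expect n [::] f = f [::].
Proof. by elim: n f => //= n IH f; rewrite IH. Qed.

Lemma step_expect_cat u v f :
  step_expect (u ++ v) f = step_expect u (fun x => step_expect v (fun y => f (x ++ y))).
Proof.
elim: u f => //= a u IH f; apply: eq_bigr => s _; rewrite IH.
congr (_ * step_expect _ _); apply/funext => x; congr step_expect.
by apply/funext => y; rewrite catA.
Qed.

End Law.

Section LawTheory.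
Variables (R : realType) (d : nat) (theta : 'I_d.+1 -> {fset word d}).
Implicit Types (u v w : word d) (n m k : nat) (f g : word d -> R).

Hypothesis Htheta : is_subst theta.

Lemma size_image_gt0 a (s : theta a) : (0 < size (val s))%N.
Proof.
have [_ nil] := Htheta a; rewrite lt0n size_eq0; apply/negP => /eqP s0.
by move: nil; rewrite -s0 (valP s).
Qed.

Lemma maxlen_gt0 : (0 < maxlen theta)%N.
Proof.
have [/fset0Pn[s sa] _] := Htheta ord0.
by apply: leq_trans (size_le_maxlen [` sa]%fset); exact: size_image_gt0.
Qed.

Variable P : 'rV[R]_(nparams theta).
Hypothesis HP : nondegenerate_data P.

Lemma param_gt0 a (s : theta a) : 0 < param P s.
Proof. by have [] := HP a. Qed.

Lemma sum_param a : \sum_(s : theta a) param P s = 1.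
Proof. by have [] := HP a. Qed.

Lemma step_expect_cst u c : step_expect P u (fun=> c) = c.
Proof.
elim: u => //= a u ->.
by rewrite -big_distrl /= sum_param mul1r.
Qed.

Lemma expect_cst n u c : expect P n u (fun=> c) = c.
Proof.
elim: n => //= n IH; rewrite -[RHS]IH; apply: eq_expect => w.
exact: step_expect_cst.
Qed.

Lemma ler_step_expect u f g :
  (forall w, (size u <= size w <= maxlen theta * size u)%N -> f w <= g w) ->
  step_expect P u f <= step_expect P u g.
Proof.
elim: u f g => [|a u IH] f g fg /=; first by apply: fg; rewrite muln0.
apply: ler_sum => s _; rewrite ler_pM2l ?param_gt0 //; apply: IH => w /andP[uw wu].
apply: fg; rewrite size_cat mulnS; apply/andP; split.
  by apply: (@leq_add 1); rewrite ?size_image_gt0.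
by rewrite leq_add ?size_le_maxlen.
Qed.

Lemma ler_expect n u f g :
  (forall w, (size u <= size w <= maxlen theta ^ n * size u)%N -> f w <= g w) ->
  expect P n u f <= expect P n u g.
Proof.
elim: n f g => [|n IH] f g fg /=; first by apply: fg; rewrite mul1n leqnn.
apply: IH => w /andP[uw wu]; apply: ler_step_expect => v /andP[wv vw].
apply: fg; rewrite (leq_trans uw) //= (leq_trans vw) // expnS -mulnA.
by rewrite leq_mul2l wu orbT.
Qed.

Lemma expect_ge0 n u f : (forall w, 0 <= f w) -> 0 <= expect P n u f.
Proof. by move=> f0; rewrite -(expect_cst n u 0); apply: ler_expect. Qed.

Lemma pr_ge0 n u w : 0 <= pr P n u w.
Proof. by apply: expect_ge0 => v; rewrite ler0n. Qed.

Lemma pr_le1 n u w : pr P n u w <= 1.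
Proof.
by rewrite -(expect_cst n u 1); apply: ler_expect => v _; case: eqP; rewrite ?ler01.
Qed.

Lemma pr_gt0_size n u w : 0 < pr P n u w -> (size u <= size w <= maxlen theta ^ n * size u)%N.
Proof.
apply: contraPT => uw; apply/negP; rewrite -leNgt -(expect_cst n u 0).
by apply: ler_expect => v vw; case: eqP => // vw'; move: uw; rewrite -vw' vw.
Qed.

Lemma expect_sum_pr n u f B : (maxlen theta ^ n * size u <= B)%N ->
  expect P n u f = \sum_(w <- words_upto d B) pr P n u w * f w.
Proof.
move=> uB; under eq_bigr do rewrite -expectZr.
rewrite -expect_sum; apply/eqP; rewrite eq_le.
apply/andP; split; apply: ler_expect => w /andP[_ wu];
  by rewrite big_words_upto_pick // (leq_trans wu).
Qed.

Lemma ler_expect_supp n u f g : (forall w, 0 < pr P n u w -> f w <= g w) ->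
  expect P n u f <= expect P n u g.
Proof.
move=> fg; rewrite !(@expect_sum_pr _ _ _ _ (leqnn _)); apply: ler_sum => w _.
have := pr_ge0 n u w; rewrite le_eqVlt => /predU1P[<-|pw]; first by rewrite !mul0r.
by rewrite ler_pM2l //; exact: fg.
Qed.

Lemma eq_expect_supp n u f g : (forall w, 0 < pr P n u w -> f w = g w) ->
  expect P n u f = expect P n u g.
Proof.
by move=> fg; apply/eqP; rewrite eq_le !ler_expect_supp // => w /fg ->.
Qed.

Lemma expect_swap n m u v (F : word d -> word d -> R) :
  expect P n u (fun x => expect P m v (F x)) =
  expect P m v (fun y => expect P n u (F^~ y)).
Proof.
rewrite (@expect_sum_pr m v _ _ (leqnn _)).
under [RHS]eq_bigr do rewrite -expectZ.
rewrite -expect_sum; apply: eq_expect => x.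
by rewrite (@expect_sum_pr m v _ _ (leqnn _)).
Qed.

(** This is where the independence of the substitutions of distinct letters is
    used. *)
Lemma expect_cat n u v f :
  expect P n (u ++ v) f = expect P n u (fun x => expect P n v (fun y => f (x ++ y))).
Proof.
elim: n f => // n IH f /=; rewrite IH; apply: eq_expect => x.
transitivity (expect P n v (fun y => step_expect P x
    (fun x' => step_expect P y (fun y' => f (x' ++ y'))))).
  by apply: eq_expect => y; rewrite step_expect_cat.
exact: esym (expect_swap 1 n x v (fun x' y => step_expect P y (fun y' => f (x' ++ y')))).
Qed.

Lemma expect_cons n c u f :
  expect P n (c :: u) f = expect P n [:: c] (fun x => expect P n u (fun y => f (x ++ y))).
Proof. by rewrite -cat1s expect_cat. Qed.

Lemma pr_cat n u v x y : pr P n u x * pr P n v y <= pr P n (u ++ v) (x ++ y).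
Proof.
rewrite /pr expect_cat -expectZr; apply: ler_expect => x' _.
rewrite -expectZ; apply: ler_expect => y' _.
by case: eqP => [->|_]; case: eqP => [->|_]; rewrite ?eqxx ?mulr1 ?mul0r ?mulr0 ?ler0n.
Qed.

Lemma pr_comp n m u w v : pr P n u w * pr P m w v <= pr P (n + m) u v.
Proof.
rewrite /pr expect_comp -expectZr; apply: ler_expect => w' _.
by case: eqP => [->|_]; rewrite ?mul1r // mul0r; exact: pr_ge0.
Qed.

Definition letter_sum (f : 'I_d.+1 -> R) w : R := \sum_(c <- w) f c.

Lemma letter_sum_cons (f : 'I_d.+1 -> R) c w :
  letter_sum f (c :: w) = f c + letter_sum f w.
Proof. exact: big_cons. Qed.

Lemma letter_sum_cat (f : 'I_d.+1 -> R) u v :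
  letter_sum f (u ++ v) = letter_sum f u + letter_sum f v.
Proof. exact: big_cat. Qed.

(** Expectations of additive functionals are additive. On letters this is the
    action of the transpose of the n-th power of the substitution matrix. *)
Lemma expect_letter_sum n w (f : 'I_d.+1 -> R) :
  expect P n w (letter_sum f) = letter_sum (fun c => expect P n [:: c] (letter_sum f)) w.
Proof.
elim: w => [|c w IH]; first by rewrite expect_nil /letter_sum !big_nil.
rewrite expect_cons letter_sum_cons -IH -[in RHS](expect_cst n [:: c] (expect P n w _)) -expectD.
apply: eq_expect => x; rewrite -(expect_cst n w (letter_sum f x)) -expectD.
by apply: eq_expect => y; rewrite letter_sum_cat.
Qed.

End LawTheory.

(** * The transition probabilities as expectations *)

Section Bridge.
Variables (R : realType) (d : nat) (theta : 'I_d.+1 -> {fset word d}).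
Hypothesis Htheta : is_subst theta.
Variable P : 'rV[R]_(nparams theta).
Hypothesis HP : nondegenerate_data P.
Implicit Types (u v w : word d) (n m k : nat) (f g : word d -> R).

(** A word v has at most one prefix equal to a given image s, so of all ways of
    cutting v only the one after size s positions contributes. *)
Lemma step_probE u v : step_prob P u v = pr P 1 u v.
Proof.
rewrite /pr /=; elim: u v => [|a u IH] v /=; first by rewrite eq_sym.
transitivity (\sum_(i < (size v).+1)
    letter_prob P a (take i v) * step_prob P u (drop i v)); first by [].
under [LHS]eq_bigr do rewrite /letter_prob mulr_suml big_mkcond /=.
rewrite exchange_big /=; apply: eq_bigr => s _; rewrite -big_mkcond /=.
case: (boolP (prefix (val s) v)) => [/prefixP[v' ->]|sv].
  have sv : (size (val s) < (size (val s ++ v')).+1)%N by rewrite size_cat ltnS leq_addr.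
  rewrite (big_pred1 (Ordinal sv)) => [|i] /=.
    rewrite drop_size_cat // IH; congr (_ * step_expect _ _ _); apply/funext => w.
    by rewrite eqseq_cat // eqxx.
  apply/eqP/eqP => [si|->]; last by rewrite take_size_cat.
  by apply: val_inj; rewrite /= (congr1 size si) size_takel // -ltnS.
rewrite big_pred0 => [|i]; last first.
  by apply: contraNF sv => /eqP /= si; rewrite /= si; exact: prefix_take.
rewrite (_ : (fun _ => _) = fun=> 0) ?(step_expect_cst HP) ?mulr0 //; apply/funext => w.
by case: eqP => // svw; move: sv; rewrite -svw prefix_prefix.
Qed.

Lemma fsum_words f B : (forall w, (B < size w)%N -> f w = 0) ->
  \sum_(w \in [set: word d]) f w = \sum_(w <- words_upto d B) f w.
Proof.
move=> f0; rewrite (fsbig_seq _ _ (words_upto_uniq d B)); apply: esym.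
apply: fsbig_widen => // w [_ /= /negP]; rewrite mem_words_upto -ltnNge.
exact: f0.
Qed.

Lemma iter_probE n u v : iter_prob P n u v = pr P n u v.
Proof.
elim: n u v => [|n IH] u v; first by rewrite /pr /= eq_sym.
rewrite /= (@fsum_words _ (maxlen theta ^ n * size u)) => [|w wu].
  under eq_bigr do rewrite IH step_probE.
  rewrite /pr /= (expect_sum_pr Htheta HP _ (leqnn _)) //.
rewrite IH; have [/(pr_gt0_size Htheta HP)/andP[_]|pr0] := ltP 0 (pr P n u w).
  by rewrite leqNgt wu.
by rewrite (le_anti (introT andP (conj pr0 (pr_ge0 Htheta HP n u w)))) mul0r.
Qed.

Lemma subst_expectationE n u f : subst_expectation P n u f = expect P n u f.
Proof.
rewrite /subst_expectation (expect_sum_pr Htheta HP _ (leqnn _)).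
rewrite (@fsum_words _ (maxlen theta ^ n * size u)) => [|w wu].
  by under eq_bigr do rewrite iter_probE.
rewrite iter_probE; have [/(pr_gt0_size Htheta HP)/andP[_]|pr0] := ltP 0 (pr P n u w).
  by rewrite leqNgt wu.
by rewrite (le_anti (introT andP (conj pr0 (pr_ge0 Htheta HP n u w)))) mul0r.
Qed.

End Bridge.

(** * Letter frequencies and the growth rate *)

Section Occurrences.
Variables (R : realType) (d : nat).
Implicit Types (u v w : word d) (n : nat).

Definition len w : R := (size w)%:R.

Lemma occ_cons v x w : occ v (x :: w) = (prefix v (x :: w) + occ v w)%N.
Proof.
rewrite /occ /=; congr (_ + _)%N.
by rewrite (iotaDl 1 0) count_map.
Qed.

Lemma letter_sum_occ (f : 'I_d.+1 -> R) w :
  letter_sum f w = \sum_c f c * (occ [:: c] w)%:R.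
Proof.
elim: w => [|x w IH]; first by rewrite /letter_sum big_nil big1 // => c _; rewrite mulr0.
rewrite letter_sum_cons IH; under [RHS]eq_bigr do rewrite occ_cons natrD mulrDr.
rewrite big_split; congr (_ + _) => /=.
rewrite (bigD1 x) //= eqxx prefix0s mulr1 big1 ?addr0 // => c /negbTE.
by move=> ->; rewrite mulr0.
Qed.

Lemma letter_sum_len w : letter_sum (fun=> 1) w = len w.
Proof. by rewrite /letter_sum big_const_seq count_predT iter_addr_0. Qed.

(** Windows that would stick out of the word cost nothing, so that the sum over
    all starting positions sees exactly the occurrences of words of length n. *)
Definition window_cost n (c : word d -> R) w : R :=
  if (n <= size w)%N then c (take n w) else 0.

Lemma sum_occ n (c : word d -> R) w :
  \sum_(u <- words d n) c u * (occ u w)%:R =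
  \sum_(0 <= p < size w) window_cost n c (drop p w).
Proof.
elim: w => [|x w IH]; first by rewrite big_geq // big1 // => u _; rewrite mulr0.
under eq_bigr do rewrite occ_cons natrD mulrDr.
rewrite big_split big_nat_recl // drop0; congr (_ + _); last exact: IH.
rewrite /window_cost; case: ifPn => [nw|wn].
  rewrite -[RHS](@big_words_pick _ R n c (take n (x :: w))) ?size_takel //.
  rewrite big_seq [RHS]big_seq; apply: eq_bigr => u; rewrite mem_words => /eqP un.
  by rewrite mulrC prefix_eq_take un.
rewrite big_seq big1 // => u; rewrite mem_words => /eqP un.
case: prefixP => [[s xws]|]; last by rewrite mulr0.
by move: wn; rewrite xws size_cat un leq_addr.
Qed.

Lemma len_ge1 w : (0 < size w)%N -> 1 <= len w.
Proof. by rewrite /len ler1n. Qed.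

End Occurrences.

Section Frequencies.
Variables (R : realType) (d : nat) (theta : 'I_d.+1 -> {fset word d}).
Hypothesis Htheta : is_subst theta.
Variable P : 'rV[R]_(nparams theta).
Hypothesis HP : nondegenerate_data P.
Implicit Types (u v w : word d) (n m k : nat) (f g : 'I_d.+1 -> R).

(** The condition on a frequency measure that determines its block entropies. *)
Definition word_frequencies (phi : word d -> R) : Prop :=
  forall u a, u != [::] ->
    (fun k => expect P k [:: a] (fun w => (occ u w)%:R) / expect P k [:: a] (@len R d))
      @ \oo --> phi u.

Variable phi : word d -> R.
Hypothesis Hphi : word_frequencies phi.

Lemma expect_len_ge1 k a : 1 <= expect P k [:: a] (@len R d).
Proof.
rewrite -(expect_cst HP k [:: a] 1); apply: (ler_expect Htheta HP) => w /andP[aw _].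
exact: len_ge1.
Qed.

Lemma expect_len_gt0 k a : 0 < expect P k [:: a] (@len R d).
Proof. exact: lt_le_trans ltr01 (expect_len_ge1 k a). Qed.

(** The letter frequencies form the right Perron-Frobenius eigenvector of the
    substitution matrix; letter functions are integrated against it. *)
Definition letter_mean f : R := \sum_c phi [:: c] * f c.

(** The Perron-Frobenius eigenvalue, as the mean length of the image of a letter. *)
Definition growth_rate : R := letter_mean (fun c => expect P 1 [:: c] (@len R d)).

Lemma phi_ge0 u : u != [::] -> 0 <= phi u.
Proof.
move=> u0; apply: (cvgr_to_ge (Hphi ord0 u0)).
by near=> k; rewrite divr_ge0 ?(expect_ge0 Htheta HP) // => w; rewrite ler0n.
Unshelve. all: by end_near. Qed.

Lemma cvg_sum_seq (T : Type) (F : set_system T) {FF : Filter F} (I : eqType) (r : seq I)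
    (h : I -> T -> R) (l : I -> R) : (forall i, i \in r -> h i @ F --> l i) ->
  (fun x => \sum_(i <- r) h i x) @ F --> \sum_(i <- r) l i.
Proof.
elim: r => [|i r IH] hl.
  by rewrite big_nil; under eq_fun do rewrite big_nil; exact: cvg_cst.
rewrite big_cons; under eq_fun do rewrite big_cons.
apply: cvgD; first by apply: hl; rewrite mem_head.
by apply: IH => j jr; apply: hl; rewrite in_cons jr orbT.
Qed.

Lemma sum_freq_cvg n (c : word d -> R) a : (0 < n)%N ->
  (fun k => expect P k [:: a] (fun w => \sum_(u <- words d n) c u * (occ u w)%:R) /
            expect P k [:: a] (@len R d))
    @ \oo --> \sum_(u <- words d n) c u * phi u.
Proof.
move=> n0.
under eq_fun do rewrite expect_sum mulr_suml.
apply: cvg_sum_seq => u; rewrite mem_words => /eqP un.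
under eq_fun do rewrite expectZ -mulrA.
by apply: cvgMr; apply: Hphi; rewrite -size_eq0 un -lt0n.
Qed.

Lemma letter_mean_cvg f a :
  (fun k => expect P k [:: a] (letter_sum f) / expect P k [:: a] (@len R d))
    @ \oo --> letter_mean f.
Proof.
rewrite (_ : letter_mean f = \sum_(u <- words d 1) letter_sum f u * phi u).
  under eq_fun do rewrite (eq_expect P _ _ (@letter_sum_occ R d f)).
  have := @sum_freq_cvg 1 (letter_sum f) a isT; apply: cvg_trans.
  apply: near_eq_cvg; near=> k; congr (_ / _); apply: eq_expect => w.
  rewrite big_wordsS; apply: eq_bigr => c _.
  by rewrite big_words0 /letter_sum big_seq1.
rewrite big_wordsS; apply: eq_bigr => c _.
by rewrite big_words0 /letter_sum big_seq1 mulrC.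
Unshelve. all: by end_near. Qed.

Lemma letter_mean1 : letter_mean (fun=> 1) = 1.
Proof.
have /cvg_lim <- // := @letter_mean_cvg (fun=> 1) ord0.
apply/cvg_lim => //; apply: (@cvg_trans _ ((fun=> 1 : R) @ \oo)); last exact: cvg_cst.
apply: near_eq_cvg; near=> k.
by rewrite (eq_expect P _ _ (@letter_sum_len R d)) divff // gt_eqF ?expect_len_gt0.
Unshelve. all: by end_near. Qed.

Lemma ler_letter_mean f g : (forall c, f c <= g c) -> letter_mean f <= letter_mean g.
Proof. by move=> fg; apply: ler_sum => c _; rewrite ler_wpM2l ?phi_ge0. Qed.

Lemma letter_meanD f g :
  letter_mean (fun c => f c + g c) = letter_mean f + letter_mean g.
Proof. by rewrite -big_split; apply: eq_bigr => c _ /=; rewrite mulrDr. Qed.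

Lemma letter_meanZ x f : letter_mean (fun c => x * f c) = x * letter_mean f.
Proof. by rewrite big_distrr; apply: eq_bigr => c _ /=; rewrite mulrCA. Qed.

Lemma letter_meanB f g :
  letter_mean (fun c => f c - g c) = letter_mean f - letter_mean g.
Proof. by rewrite -sumrB; apply: eq_bigr => c _ /=; rewrite mulrBr. Qed.

Lemma letter_mean_cst x : letter_mean (fun=> x) = x.
Proof.
rewrite -[RHS]mulr1 -letter_mean1 -letter_meanZ.
by apply: eq_bigr => c _; rewrite mulr1.
Qed.

(** The eigenvector equation. Both sides are limits of the same sequence, since
    the mean of f over the iterate k + 1 can be computed from the iterate k. *)
Lemma letter_mean_expect1 f :
  letter_mean (fun c => expect P 1 [:: c] (letter_sum f)) = growth_rate * letter_mean f.
Proof.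
have Tf := @letter_mean_cvg (fun c => expect P 1 [:: c] (letter_sum f)) ord0.
have T1 := @letter_mean_cvg (fun c => expect P 1 [:: c] (@len R d)) ord0.
have f1 := @letter_mean_cvg f ord0; rewrite -(cvg_shiftS _ _) /= in f1.
rewrite -(cvg_lim (@Rhausdorff R) Tf) -(cvg_lim (@Rhausdorff R) (cvgM T1 f1)).
congr (lim (_ @ \oo)); apply/funext => k /=.
have E g : expect P k.+1 [:: ord0] (letter_sum g) = expect P k [:: ord0]
    (letter_sum (fun c => expect P 1 [:: c] (letter_sum g))).
  rewrite -addn1 expect_comp; apply: eq_expect => w.
  exact: (expect_letter_sum Htheta HP).
have Elen : expect P k [:: ord0] (letter_sum (fun c => expect P 1 [:: c] (@len R d))) =
    expect P k.+1 [:: ord0] (@len R d).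
  by rewrite -(funext (@letter_sum_len R d)) E.
rewrite -E Elen [RHS]mulrC mulrA divfK //.
exact: lt0r_neq0 (expect_len_gt0 k.+1 ord0).
Qed.

Lemma letter_mean_expect m f :
  letter_mean (fun c => expect P m [:: c] (letter_sum f)) =
  growth_rate ^+ m * letter_mean f.
Proof.
elim: m => [|m IH]; first by rewrite mul1r; apply: eq_bigr => c _; rewrite /= /letter_sum big_seq1.
rewrite exprS -mulrA -IH -letter_mean_expect1; apply: eq_bigr => c _; congr (_ * _).
rewrite -add1n expect_comp; apply: eq_expect => w.
exact: (expect_letter_sum Htheta HP).
Qed.

Lemma letter_mean_len m : letter_mean (fun c => expect P m [:: c] (@len R d)) =
  growth_rate ^+ m.
Proof.
by rewrite -[RHS]mulr1 -letter_mean1 -letter_mean_expect (funext (@letter_sum_len R d)).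
Qed.

Lemma growth_rate_ge1 : 1 <= growth_rate.
Proof. by rewrite -letter_mean1; apply: ler_letter_mean => c; exact: expect_len_ge1. Qed.

Lemma growth_rate_gt0 : 0 < growth_rate.
Proof. exact: lt_le_trans growth_rate_ge1. Qed.

Lemma len_ratio_cvg m a :
  (fun k => expect P (k + m) [:: a] (@len R d) / expect P k [:: a] (@len R d))
    @ \oo --> growth_rate ^+ m.
Proof.
rewrite -letter_mean_len; have := @letter_mean_cvg (fun c => expect P m [:: c] (@len R d)) a.
apply: cvg_trans; apply: near_eq_cvg; near=> k; congr (_ / _).
rewrite expect_comp; apply: eq_expect => w.
by rewrite -(funext (@letter_sum_len R d)) (expect_letter_sum Htheta HP).
Unshelve. all: by end_near. Qed.

Lemma sum_phi_le1 n : (0 < n)%N -> \sum_(u <- words d n) phi u <= 1.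
Proof.
move=> n0; have := @sum_freq_cvg n (fun=> 1) ord0 n0.
under [in X in _ --> X]eq_bigr do rewrite mul1r.
move=> /cvgr_to_le; apply; near=> k.
rewrite ler_pdivrMr ?expect_len_gt0 // mul1r; apply: (ler_expect Htheta HP) => w _.
rewrite (eq_bigr (fun u => 1 * (occ u w)%:R)) => [|u _]; last by rewrite mul1r.
rewrite sum_occ -[leRHS]mulr1 mulr_natl -[X in _ *+ X]subn0 -sumr_const_nat.
by apply: ler_sum => p _; rewrite /window_cost; case: ifP.
Unshelve. all: by end_near. Qed.

End Frequencies.

(** * Entropy of the iterates: almost subadditivity of the recognition cost *)

Section Gibbs.
Variable R : realType.
Implicit Types p q x : R.

(** Summed over a distribution p, this is the inequality of Gibbs: the entropy
    of p is at most its cross entropy relative to q. *)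
Lemma gibbs p q : 0 <= p -> 0 <= q -> (0 < p -> 0 < q) ->
  p * (ln q - ln p) <= q - p.
Proof.
rewrite le_eqVlt => /predU1P[<-|p0] q0 pq; first by rewrite mul0r subr0.
have {}q0 := pq p0; rewrite -ln_div // (_ : q - p = p * (q / p - 1)).
  rewrite ler_pM2l //; have := @le_ln1Dx R (q / p - 1); rewrite [1 + _]addrC subrK; apply.
  by rewrite ltrBrDl subrr divr_gt0.
by rewrite mulrBr mulr1 mulrC divfK // gt_eqF.
Qed.

End Gibbs.

Section Entropy.
Variables (R : realType) (d : nat) (theta : 'I_d.+1 -> {fset word d}).
Hypothesis Htheta : is_subst theta.
Variable P : 'rV[R]_(nparams theta).
Hypothesis HP : nondegenerate_data P.
Implicit Types (u v w : word d) (n m k : nat) (a c : 'I_d.+1).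

Local Notation K := (maxlen theta).

Definition entropy_of_iterate m c : R :=
  expect P m [:: c] (fun w => - ln (pr P m [:: c] w)).

Section Parsing.
Variables m : nat.

(** The factor paid by a block for naming its letter and its length, both drawn
    uniformly. *)
Definition block_weight : R := ((d.+1 * K ^ m.+1)%N%:R)^-1.

(** The logarithm of the factor that one block contributes to the ratio whose
    expectation is bounded in the proof of entropy_increment_le. *)
Definition block_gain c A B : R :=
  ln block_weight + ln (pr P m [:: c] A) - ln (pr P m.+1 [:: c] B).

(** The expectation over the images A of X under m steps and B of A under one
    more step, with x the accumulated gain of the blocks. *)
Fixpoint pair_expect (X : word d) (F : word d -> word d -> R -> R) : R :=
  if X is c :: X' then
    expect P m [:: c] (fun A => step_expect P A (fun B =>
      pair_expect X' (fun A' B' x => F (A ++ A') (B ++ B') (block_gain c A B + x))))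
  else F [::] [::] 0.

(** Dividing by the probability of each block B turns the expectation into a
    weighted sum over the possible ways of parsing a word into images of the
    letters of X. *)
Fixpoint parse_expect (X : word d) (psi : word d -> R) : R :=
  if X is c :: X' then
    expect P m.+1 [:: c] (fun B =>
      block_weight / pr P m.+1 [:: c] B * parse_expect X' (fun B' => psi (B ++ B')))
  else psi [::].

Lemma block_weight_gt0 : 0 < block_weight.
Proof. by rewrite invr_gt0 ltr0n muln_gt0 expn_gt0 maxlen_gt0. Qed.

Lemma eq_pair_expect X F G : (forall A B x, F A B x = G A B x) ->
  pair_expect X F = pair_expect X G.
Proof.
by move=> FG; congr pair_expect; apply/funext => A; apply/funext => B; apply/funext.
Qed.

Lemma pair_expectD X F G :
  pair_expect X (fun A B x => F A B x + G A B x) = pair_expect X F + pair_expect X G.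
Proof.
elim: X F G => //= c X IH F G; rewrite -expectD; apply: eq_expect => A.
by rewrite -step_expectD; congr step_expect; apply/funext => B; rewrite IH.
Qed.

Lemma pair_expectZ X r F :
  pair_expect X (fun A B x => r * F A B x) = r * pair_expect X F.
Proof.
elim: X F => //= c X IH F; rewrite -expectZ; apply: eq_expect => A.
by rewrite -step_expectZ; congr step_expect; apply/funext => B; rewrite IH.
Qed.

Lemma pair_expect_fst X f : pair_expect X (fun A _ _ => f A) = expect P m X f.
Proof.
elim: X f => [|c X IH] f; first by rewrite expect_nil.
rewrite (expect_cons Htheta HP) /=; apply: eq_expect => A.
by rewrite IH step_expect_cst.
Qed.

Lemma pair_expect_snd X f : pair_expect X (fun _ B _ => f B) = expect P m.+1 X f.
Proof.
elim: X f => [|c X IH] f; first by rewrite expect_nil.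
rewrite (expect_cons Htheta HP) /=; apply: eq_expect => A.
by congr step_expect; apply/funext => B; rewrite IH.
Qed.

Lemma pair_expect_cst X x : pair_expect X (fun _ _ _ => x) = x.
Proof. by rewrite (pair_expect_fst X (fun=> x)) (expect_cst HP). Qed.

Lemma pair_expect_gain X : pair_expect X (fun _ _ x => x) =
  letter_sum (fun c =>
    ln block_weight - entropy_of_iterate m c + entropy_of_iterate m.+1 c) X.
Proof.
elim: X => [|c X IH]; first by rewrite /letter_sum big_nil.
rewrite letter_sum_cons -IH /=.
transitivity (expect P m [:: c] (fun A => step_expect P A (fun B =>
   (ln block_weight + ln (pr P m [:: c] A)) - ln (pr P m.+1 [:: c] B))) +
   pair_expect X (fun _ _ x => x)).
  rewrite -[X in _ = _ + X](expect_cst HP m [:: c]) -expectD; apply: eq_expect => A.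
  rewrite -[X in _ = _ + X](step_expect_cst HP A) -step_expectD.
  congr step_expect; apply/funext => B.
  by rewrite pair_expectD pair_expect_cst.
congr (_ + _).
transitivity (expect P m [:: c] (fun A => ln block_weight + ln (pr P m [:: c] A)) -
   expect P m.+1 [:: c] (fun B => ln (pr P m.+1 [:: c] B))).
  rewrite -expectN /= -expectD; apply: eq_expect => A.
  by rewrite step_expectD (step_expect_cst HP).
rewrite expectD (expect_cst HP) /entropy_of_iterate !expectN opprK; ring.
Qed.

Lemma ler_pair_expect X F G :
  (forall A B x, 0 < pr P m X A -> 0 < pr P m.+1 X B -> F A B x <= G A B x) ->
  pair_expect X F <= pair_expect X G.
Proof.
elim: X F G => [|c X IH] F G FG /=.
  by apply: FG; rewrite /pr expect_nil eqxx ltr01.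
apply: (ler_expect_supp Htheta HP) => A pA.
apply: (ler_expect_supp Htheta HP (n := 1)) => B pB.
apply: IH => A' B' x pA' pB'; apply: FG.
  by apply: lt_le_trans (pr_cat Htheta HP m [:: c] X A A'); rewrite mulr_gt0.
apply: lt_le_trans (pr_cat Htheta HP m.+1 [:: c] X B B'); rewrite mulr_gt0 //.
rewrite -addn1; apply: lt_le_trans (pr_comp Htheta HP m 1 [:: c] A B).
by rewrite mulr_gt0.
Qed.

Lemma parse_expect_ge0 X psi : (forall B, 0 <= psi B) -> 0 <= parse_expect X psi.
Proof.
elim: X psi => //= c X IH psi psi0; apply: (expect_ge0 Htheta HP m.+1) => B.
by rewrite mulr_ge0 ?IH // divr_ge0 ?(ltW block_weight_gt0) ?(pr_ge0 Htheta HP).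
Qed.

Lemma parse_expectZ X r psi : parse_expect X (fun B => r * psi B) = r * parse_expect X psi.
Proof.
elim: X psi => //= c X IH psi; rewrite -[RHS](expectZ P m.+1 [:: c]).
by apply: (eq_expect P m.+1 [:: c]) => B; rewrite IH mulrCA.
Qed.

Lemma parse_expect0 X : parse_expect X (fun=> 0) = 0.
Proof.
elim: X => //= c X ->; rewrite -[RHS](expect0 P m.+1 [:: c]).
by apply: (eq_expect P m.+1 [:: c]) => B; rewrite mulr0.
Qed.

Lemma parse_expect_swap X n u (F : word d -> word d -> R) :
  parse_expect X (fun B => expect P n u (F^~ B)) =
  expect P n u (fun v => parse_expect X (F v)).
Proof.
elim: X F => //= c X IH F.
rewrite -[RHS](expect_swap Htheta HP m.+1 n [:: c] u
  (fun B v => block_weight / pr P m.+1 [:: c] B * parse_expect X (fun B' => F v (B ++ B')))).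
apply: (eq_expect P m.+1 [:: c]) => B.
by rewrite expectZ IH.
Qed.

(** The probability of A is at least p times the product of the probabilities of
    its blocks. This leaves one factor for each block of A, which is absorbed by
    summing over that block with its image B fixed. *)
Lemma pair_expect_le_parse X (p : R) (Q psi : word d -> R) :
  0 <= p -> (forall B, 0 <= psi B) -> (forall A, p * pr P m X A <= Q A) ->
  pair_expect X (fun A B x => p * psi B * expR x / Q A) <= parse_expect X psi.
Proof.
elim: X p Q psi => [|c X IH] p Q psi p0 psi0 pQ /=.
  have := pQ [::]; rewrite /pr expect_nil eqxx mulr1 expR0 mulr1 => {}pQ.
  have := le_trans p0 pQ; rewrite le_eqVlt => /predU1P[<-|Q0].
    by rewrite invr0 mulr0.
  by rewrite mulrAC ler_piMl // ler_pdivrMr ?mul1r.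
apply: (ler_expect_supp Htheta HP) => A pA.
apply: (ler_expect_supp Htheta HP (n := 1)) => B pB.
have {}pB : 0 < pr P m.+1 [:: c] B.
  rewrite -addn1; apply: lt_le_trans (pr_comp Htheta HP m 1 [:: c] A B).
  by rewrite mulr_gt0.
have r0 : 0 < block_weight / pr P m.+1 [:: c] B by rewrite divr_gt0 ?block_weight_gt0.
have p'0 : 0 <= p * pr P m [:: c] A by rewrite mulr_ge0 // ltW.
have psi'0 B' : 0 <= block_weight / pr P m.+1 [:: c] B * psi (B ++ B').
  by rewrite mulr_ge0 // ltW.
have p'Q A' : p * pr P m [:: c] A * pr P m X A' <= Q (A ++ A').
  apply: le_trans (pQ _); rewrite -mulrA ler_wpM2l //.
  exact: (pr_cat Htheta HP m [:: c]).
have := IH _ _ _ p'0 psi'0 p'Q; rewrite parse_expectZ; apply: le_trans.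
rewrite le_eqVlt; apply/orP; left; apply/eqP; apply: eq_pair_expect => A' B' x.
rewrite !expRD expRN !lnK ?posrE ?block_weight_gt0 //; ring.
Qed.

(** A fixed word, cut into blocks that are each charged the weight of their
    length, has total mass at most one over all ways of cutting it: this is the
    probability that a renewal process visits a given point. *)
Lemma sum_parse_expect_le1 N B0 :
  \sum_(X <- words_upto d N) parse_expect X (fun B => (B0 == B)%:R) <= 1.
Proof.
have parse_cons c X v : parse_expect (c :: X) (fun B => (v == B)%:R) <=
    block_weight * \sum_(0 <= t < (K ^ m.+1)%N)
      (t < size v)%N%:R * parse_expect X (fun B => (drop t.+1 v == B)%:R).
  (* Only the prefixes of v can be its first block. *)
  rewrite [leLHS](expect_sum_pr Htheta HP (n := m.+1) _ (leqnn _)) big_words_upto.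
  rewrite muln1 big_nat_recl // big_words0.
  have -> : pr P m.+1 [:: c] [::] = 0.
    apply/eqP; rewrite eq_le (pr_ge0 Htheta HP) andbT leNgt.
    by apply/negP => /(pr_gt0_size Htheta HP).
  rewrite mul0r add0r mulr_sumr; apply: ler_sum => t _.
  have parse_ge0 w : 0 <= parse_expect X (fun B => (w == B)%:R).
    by apply: parse_expect_ge0 => B; rewrite ler0n.
  apply: (@le_trans _ _ (\sum_(B <- words d t.+1) block_weight *
      parse_expect X (fun B' => (v == B ++ B')%:R))).
    apply: ler_sum => B _.
    have [->|p0] := eqVneq (pr P m.+1 [:: c] B) 0.
      rewrite mul0r mulr_ge0 ?(ltW block_weight_gt0) //.
      by apply: parse_expect_ge0 => B'; rewrite ler0n.
    by rewrite mulrA [_ * (_ / _)]mulrC divfK.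
  rewrite -mulr_sumr ler_wpM2l ?(ltW block_weight_gt0) //.
  case: ltnP => [tv|vt]; last first.
    rewrite mul0r big_seq big1 // => B; rewrite mem_words => /eqP Bt.
    rewrite -[RHS](parse_expect0 X); congr parse_expect; apply/funext => B'.
    by case: eqP => // vB; move: vt; rewrite vB size_cat Bt ltnNge leq_addr.
  rewrite mul1r le_eqVlt; apply/orP; left; apply/eqP.
  rewrite -[RHS](@big_words_pick d R t.+1 (fun=> parse_expect X _) (take t.+1 v)).
    rewrite big_seq [RHS]big_seq; apply: eq_bigr => B; rewrite mem_words => /eqP Bt.
    rewrite -parse_expectZ; congr parse_expect; apply/funext => B'.
    rewrite -{1}(cat_take_drop t.+1 v) eqseq_cat ?size_takel ?Bt // eq_sym.
    by case: (_ == _); rewrite ?mul1r ?mul0r.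
  by rewrite size_takel.
have card_block : d.+1%:R * block_weight *+ (K ^ m.+1)%N = 1.
  rewrite -mulr_natl mulrA -natrM mulnC divff // pnatr_eq0 muln_eq0 negb_or /=.
  by rewrite -lt0n expn_gt0 maxlen_gt0.
elim: N B0 => [|N IH] v.
  by rewrite big_words_upto big_nat1 big_words0 /=; case: eqP; rewrite ?ler01.
rewrite big_words_uptoS /=.
apply: (@le_trans _ _ ((v == [::])%:R +
   \sum_(c < d.+1) block_weight * \sum_(0 <= t < (K ^ m.+1)%N) (t < size v)%N%:R)).
  rewrite lerD2l; apply: ler_sum => c _.
  apply: le_trans (ler_sum _ (fun X _ => parse_cons c X v)) _.
  rewrite -mulr_sumr ler_wpM2l ?(ltW block_weight_gt0) // exchange_big /=.
  by apply: ler_sum => t _; rewrite -mulr_sumr ler_piMr.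
rewrite sumr_const card_ord; case: v => [|x v] /=.
  by rewrite big1 // mulr0 mul0rn addr0.
rewrite add0r -mulr_natl mulrA -[leRHS]card_block -[leRHS]mulr_natr.
rewrite ler_wpM2l ?mulr_ge0 ?(ltW block_weight_gt0) //.
rewrite -[X in _ <= X%:R]subn0 -sumr_const_nat.
by apply: ler_sum => t _; case: ltnP.
Qed.

(** Write X for the k-th iterate, A_i for the image after m steps of the i-th
    letter of X, and B_i for the image of A_i under one more step. Given A, the
    choices made in the last step have the same entropy whether they are made in
    A or block by block, so they drop out of the comparison. What is left
    compares P(B)/P(A) with the product of the P(B_i)/P(A_i): the quotient of the
    two has expectation at most one once each block pays for its letter and its
    length, and the logarithm is concave. *)
Lemma entropy_increment_le k a :
  entropy_of_iterate (k + m) a - entropy_of_iterate (k + m).+1 a <=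
  expect P k [:: a] (letter_sum (fun c =>
    entropy_of_iterate m c - entropy_of_iterate m.+1 c - ln block_weight)).
Proof.
pose pA := pr P (k + m) [:: a]; pose pB := pr P (k + m).+1 [:: a].
have pA_ge X A : pr P k [:: a] X * pr P m X A <= pA A.
  exact: (pr_comp Htheta HP).
have pB_ge X B : pr P k [:: a] X * pr P m.+1 X B <= pB B.
  by rewrite /pB -addnS; exact: (pr_comp Htheta HP).
have tangent : expect P k [:: a] (fun X => pair_expect X
    (fun A B x => ln (pB B) - ln (pA A) + x)) <=
  expect P k [:: a] (fun X => pair_expect X (fun A B x => pB B * expR x / pA A)) - 1.
  rewrite -[X in _ - X](expect_cst HP k [:: a]) -expectB.
  apply: (ler_expect_supp Htheta HP) => X pX.
  rewrite lerBrDr -[X in _ + X](pair_expect_cst X) -pair_expectD.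
  apply: ler_pair_expect => A B x pXA pXB.
  have A0 : 0 < pA A by apply: lt_le_trans (pA_ge X A); rewrite mulr_gt0.
  have B0 : 0 < pB B by apply: lt_le_trans (pB_ge X B); rewrite mulr_gt0.
  have -> : pB B * expR x / pA A = expR (ln (pB B) - ln (pA A) + x).
    by rewrite !expRD expRN !lnK ?posrE // mulrAC.
  by rewrite addrC expR_ge1Dx.
have mass : expect P k [:: a] (fun X => pair_expect X (fun A B x => pB B * expR x / pA A)) <= 1.
  rewrite (expect_sum_pr Htheta HP _ (leqnn _)).
  set N := (_ * _)%N.
  apply: (@le_trans _ _ (\sum_(X <- words_upto d N) parse_expect X pB)).
    apply: ler_sum => X _.
    have pB0 B : 0 <= pB B by exact: (pr_ge0 Htheta HP).
    apply: le_trans (pair_expect_le_parse (pr_ge0 Htheta HP k [:: a] X) pB0 (pA_ge X)).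
    rewrite -pair_expectZ le_eqVlt; apply/orP; left; apply/eqP.
    by apply: eq_pair_expect => A B x; rewrite !mulrA.
  under eq_bigr do rewrite parse_expect_swap.
  rewrite -expect_sum -[leRHS](expect_cst HP (k + m).+1 [:: a]).
  apply: (ler_expect Htheta HP (n := (k + m).+1)) => B0 _.
  exact: sum_parse_expect_le1.
have {tangent mass} := le_trans tangent (lerB mass (lexx 1)); rewrite subrr.
rewrite (eq_expect P k [:: a] (g := fun X =>
   expect P m.+1 X (fun B => ln (pB B)) - expect P m X (fun A => ln (pA A)) -
   letter_sum (fun c => entropy_of_iterate m c - entropy_of_iterate m.+1 c - ln block_weight) X)).
  rewrite expectD expectB expectN -!expect_comp addnS.
  by rewrite /entropy_of_iterate !expectN /pA /pB; lra.
move=> X; rewrite !pair_expectD pair_expect_gain.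
rewrite (pair_expect_snd X (fun B => ln (pB B))) (pair_expect_fst X (fun A => - ln (pA A))).
rewrite expectN /letter_sum -sumrN; congr (_ + _); apply: eq_bigr => c _; ring.
Qed.

End Parsing.
End Entropy.

(** * Block entropies are at most the entropy of the iterates *)

Section UpperBound.
Variables (R : realType) (d : nat) (theta : 'I_d.+1 -> {fset word d}).
Hypothesis Htheta : is_subst theta.
Variable P : 'rV[R]_(nparams theta).
Hypothesis HP : nondegenerate_data P.
Implicit Types (u v w : word d) (n k N j t : nat) (a c : 'I_d.+1)
  (l : seq ('I_d.+1 * word d)).

Local Notation K := (maxlen theta).

Lemma sum_nat_add (F : nat -> R) (a b : nat) :
  \sum_(0 <= t < a + b) F t = \sum_(0 <= t < a) F t + \sum_(0 <= t < b) F (a + t)%N.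
Proof.
elim: b => [|b IH]; first by rewrite addn0 [X in _ + X]big_geq ?addr0.
by rewrite addnS !big_nat_recr //= IH addrA.
Qed.

Variable m : nat.

Definition block_cost (p : 'I_d.+1 * word d) : R :=
  ln d.+1%:R - ln (pr P m [:: p.1] p.2).

Definition blocks_word l : word d := flatten [seq p.2 | p <- l].

Definition possible_blocks l := all (fun p => 0 < pr P m [:: p.1] p.2) l.

Fixpoint block_expect (X : word d) (F : seq ('I_d.+1 * word d) -> R) : R :=
  if X is c :: X' then
    expect P m [:: c] (fun v => block_expect X' (fun l => F ((c, v) :: l)))
  else F [::].

Lemma block_expect_word X f : block_expect X (fun l => f (blocks_word l)) = expect P m X f.
Proof.
elim: X f => [|c X IH] f; first by rewrite expect_nil.
rewrite (expect_cons Htheta HP) /=; apply: eq_expect => v.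
exact: (IH (fun y => f (v ++ y))).
Qed.

Lemma block_expectD X F G :
  block_expect X (fun l => F l + G l) = block_expect X F + block_expect X G.
Proof.
elim: X F G => //= c X IH F G; rewrite -expectD; apply: eq_expect => v.
by rewrite IH.
Qed.

Lemma block_expectZ X r F : block_expect X (fun l => r * F l) = r * block_expect X F.
Proof.
by elim: X F => //= c X IH F; rewrite -expectZ; apply: eq_expect => v; rewrite IH.
Qed.

Lemma block_expect_cst X r : block_expect X (fun=> r) = r.
Proof. by rewrite (block_expect_word X (fun=> r)) (expect_cst HP). Qed.

Lemma ler_block_expect X F G : (forall l, possible_blocks l -> F l <= G l) ->
  block_expect X F <= block_expect X G.
Proof.
elim: X F G => [|c X IH] F G FG /=; first exact: FG.
apply: (ler_expect_supp Htheta HP) => v pv; apply: IH => l pl; apply: FG.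
by rewrite /possible_blocks /= pv.
Qed.

Lemma block_expect_cost X : block_expect X (fun l => \sum_(p <- l) block_cost p) =
  letter_sum (fun c => ln d.+1%:R + entropy_of_iterate P m c) X.
Proof.
elim: X => [|c X IH]; first by rewrite /= /letter_sum !big_nil.
rewrite letter_sum_cons -IH /=.
rewrite -[X in X + _ + _](expect_cst HP m [:: c]) /entropy_of_iterate -expectD.
rewrite -[X in _ + X](expect_cst HP m [:: c]) -expectD; apply: eq_expect => v.
rewrite -[X in X + _](block_expect_cst X) -block_expectD.
by congr block_expect; apply/funext => l; rewrite big_cons.
Qed.

Lemma possible_block_size p : 0 < pr P m [:: p.1] p.2 -> (0 < size p.2 <= K ^ m)%N.
Proof. by move/(pr_gt0_size Htheta HP); rewrite muln1. Qed.

Lemma block_cost_ge0 p : 0 <= block_cost p.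
Proof.
rewrite subr_ge0 (@le_trans _ _ 0) //; first by rewrite ln_le0 // (pr_le1 Htheta HP).
by rewrite ln_ge0 // ler1n.
Qed.

Fixpoint prefix_cost n l : R :=
  if l is p :: l' then
    if n == 0%N then 0 else block_cost p + prefix_cost (n - size p.2) l'
  else 0.

(** A block that is entered at position j leaves n + j - size p.2 positions of the
    window to the following blocks. *)
Fixpoint blocks_cost j n l : R :=
  if l is p :: l' then
    if (j < size p.2)%N then block_cost p + prefix_cost (n + j - size p.2) l'
    else blocks_cost (j - size p.2) n l'
  else 0.

Lemma prefix_cost0 l : prefix_cost 0 l = 0.
Proof. by case: l. Qed.

Lemma prefix_cost_ge0 n l : 0 <= prefix_cost n l.
Proof.
elim: l n => //= p l IH n; case: eqP => // _.
by rewrite addr_ge0 ?block_cost_ge0.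
Qed.

Lemma blocks_cost_ge0 j n l : 0 <= blocks_cost j n l.
Proof.
elim: l j n => //= p l IH j n; case: ltnP => // _.
by rewrite addr_ge0 ?block_cost_ge0 ?prefix_cost_ge0.
Qed.

(** A block of length b meets at most n + b windows of length n. The windows
    that start to the left of the word are included to make the induction work. *)
Lemma sum_blocks_cost_aux n l :
  \sum_(0 <= j < size (blocks_word l)) blocks_cost j n l +
  \sum_(0 <= t < n) prefix_cost t l <=
  \sum_(p <- l) (n + size p.2)%:R * block_cost p.
Proof.
elim: l => [|p l IH] /=.
  by rewrite big_geq // big_nil add0r big1.
rewrite /blocks_word /= size_cat sum_nat_add big_cons -/(blocks_word l).
have -> : \sum_(0 <= t < size (blocks_word l))
    (if (size p.2 + t < size p.2)%N
     then block_cost p + prefix_cost (n + (size p.2 + t) - size p.2) l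
     else blocks_cost (size p.2 + t - size p.2) n l) =
    \sum_(0 <= t < size (blocks_word l)) blocks_cost t n l.
  by apply: eq_bigr => t _; rewrite ltnNge leq_addr /= addKn.
apply: (@le_trans _ _ (\sum_(0 <= t < size p.2) (block_cost p + prefix_cost (n + t - size p.2) l) +
  \sum_(0 <= t < size (blocks_word l)) blocks_cost t n l +
  \sum_(0 <= t < n) (block_cost p + prefix_cost (t - size p.2) l))).
  rewrite lerD //.
    rewrite lerD2r big_seq [leRHS]big_seq.
    by apply: ler_sum => t; rewrite mem_index_iota => /= ->.
  apply: ler_sum => t _; case: eqP => // _.
  by rewrite addr_ge0 ?block_cost_ge0 ?prefix_cost_ge0.
move: (block_cost p) => x; rewrite !big_split /= !sumr_const_nat !subn0.
have shift : \sum_(0 <= t < n) prefix_cost (t - size p.2) l +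
    \sum_(0 <= t < size p.2) prefix_cost (n + t - size p.2) l =
    \sum_(0 <= t < n) prefix_cost t l.
  rewrite -(sum_nat_add (fun t => prefix_cost (t - size p.2) l)) addnC sum_nat_add.
  rewrite big_seq big1 ?add0r => [|t]; last first.
    rewrite mem_index_iota => /= tp.
    by rewrite (eqP (ltnW tp : (t - size p.2 == 0)%N)) prefix_cost0.
  by apply: eq_bigr => t _; rewrite addKn.
move: IH; rewrite -shift natrD mulrDl !mulr_natl; lra.
Qed.

Lemma sum_blocks_cost n l : possible_blocks l ->
  \sum_(0 <= j < size (blocks_word l)) blocks_cost j n l <=
  (n + K ^ m)%:R * \sum_(p <- l) block_cost p.
Proof.
move=> pl; apply: (@le_trans _ _ (\sum_(p <- l) (n + size p.2)%:R * block_cost p)).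
  apply: le_trans (sum_blocks_cost_aux n l); rewrite lerDl.
  by apply: sumr_ge0 => t _; exact: prefix_cost_ge0.
rewrite mulr_sumr big_seq [leRHS]big_seq; apply: ler_sum => p /(allP pl).
move=> /possible_block_size/andP[_ pK].
by rewrite ler_wpM2r ?block_cost_ge0 // ler_nat leq_add2l.
Qed.

(** The law of the word read from position j on in the image of N independent,
    uniformly distributed letters. *)
Definition window_prob N u j : R :=
  (d.+1%:R ^+ N)^-1 *
  \sum_(Z <- words d N) expect P m Z (fun V => (prefix u (drop j V))%:R).

Lemma window_prob_ge0 N u j : 0 <= window_prob N u j.
Proof.
rewrite mulr_ge0 ?invr_ge0 ?exprn_ge0 ?ler0n // sumr_ge0 // => Z _.
by apply: (expect_ge0 Htheta HP) => V; rewrite ler0n.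
Qed.

Lemma sum_window_prob_le1 N j n : \sum_(u <- words d n) window_prob N u j <= 1.
Proof.
rewrite -mulr_sumr exchange_big /= ler_pdivrMl ?exprn_gt0 ?ltr0n // -big_words_const.
apply: ler_sum => Z _; rewrite -expect_sum -[leRHS](expect_cst HP m Z 1).
by apply: (ler_expect Htheta HP) => V _; exact: (@sum_prefix_le1 d R n (drop j V)).
Qed.

(** If the first letter is c and its image is v, the rest of u has to be found in
    the images of the remaining letters. *)
Lemma window_prob_block N c v u u' j : (j <= size v)%N ->
  (forall y, prefix u' y -> prefix u (drop j v ++ y)) ->
  pr P m [:: c] v / d.+1%:R * window_prob N u' 0 <= window_prob N.+1 u j.
Proof.
move=> jv uu'; rewrite /window_prob big_wordsS exprS invfM.
have : 0 <= (d.+1%:R ^+ N)^-1 :> R by rewrite invr_ge0 exprn_ge0.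
move: ((d.+1%:R ^+ N)^-1) => scale scale0.
rewrite (mulrC (pr _ _ _ _)) mulrACA ler_wpM2l ?mulr_ge0 ?invr_ge0 ?ler0n //.
have term0 c' : 0 <= \sum_(Z <- words d N)
    expect P m (c' :: Z) (fun V => (prefix u (drop j V))%:R) :> R.
  by apply: sumr_ge0 => Z _; apply: (expect_ge0 Htheta HP) => V; rewrite ler0n.
rewrite (bigD1 c) //= ler_wpDr ?sumr_ge0 // mulr_sumr; apply: ler_sum => Z _.
rewrite (expect_cons Htheta HP) -expectZr; apply: (ler_expect Htheta HP) => x _.
case: eqP => [->|_]; last first.
  by rewrite mul0r; apply: (expect_ge0 Htheta HP) => V; rewrite ler0n.
rewrite mul1r; apply: (ler_expect Htheta HP) => y _; rewrite drop0 drop_cat.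
have {}uu' : prefix u' y -> prefix u (if (j < size v)%N then drop j v ++ y
    else drop (j - size v) y).
  move=> /uu'; case: ltnP => // vj.
  by rewrite (eqP (jv : (j - size v == 0)%N)) drop0 drop_oversize.
by case: prefixP uu' => [_ -> //|_ _]; rewrite ler0n.
Qed.

Lemma window_prob_nil N : window_prob N [::] 0 = 1.
Proof.
rewrite /window_prob (eq_bigr (fun=> 1)) => [|Z _].
  by rewrite big_words_const mulr1 mulVf // expf_neq0 // pnatr_eq0.
rewrite -[RHS](expect_cst HP m Z); apply: eq_expect => V.
by rewrite prefix0s.
Qed.

Lemma expR_block_cost c v : 0 < pr P m [:: c] v ->
  expR (- block_cost (c, v)) = pr P m [:: c] v / d.+1%:R.
Proof. by move=> pv; rewrite opprB expRB !lnK // posrE ltr0n. Qed.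

(** As no image is empty, n letters suffice to cover n positions. *)
Lemma prefix_prob_ge l N n : possible_blocks l -> (n <= N)%N ->
  (n <= size (blocks_word l))%N ->
  expR (- prefix_cost n l) <= window_prob N (take n (blocks_word l)) 0.
Proof.
elim: l N n => [|[c v] l IH] N n pl nN /=.
  by rewrite oppr0 expR0 window_prob_nil.
case: (posnP n) => [->|n0]; first by rewrite oppr0 expR0 take0 window_prob_nil.
rewrite /blocks_word /= -/(blocks_word l) size_cat => nl.
move: pl => /andP[/= pv pl].
have /andP[/= v0 _] := possible_block_size (p := (c, v)) pv.
case: N nN => [|N] nN; first by move: nN; rewrite leqNgt n0.
apply: le_trans (window_prob_block N c (v := v) (u' := take (n - size v) (blocks_word l)) (leq0n _) _).
  rewrite opprD expRD expR_block_cost // ler_wpM2l ?divr_ge0 ?(ltW pv) //.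
  by apply: IH => //; [rewrite leq_subLR; apply: leq_trans nN _; rewrite -add1n leq_add2r
                      |rewrite leq_subLR].
move=> y; rewrite drop0 take_cat; case: ltnP => [nv _|vn].
  by rewrite -{2}(cat_take_drop n v) -catA prefix_prefix.
by rewrite prefix_catr ?eqxx.
Qed.

(** The window starts inside a block, at one of less than K ^ m positions; one more
    letter is needed for this incomplete block. *)
Lemma window_prob_ge l n j : possible_blocks l -> (j + n <= size (blocks_word l))%N ->
  (j < size (blocks_word l))%N -> exists2 j', (j' < K ^ m)%N &
  expR (- blocks_cost j n l) <= window_prob n.+1 (take n (drop j (blocks_word l))) j'.
Proof.
elim: l j => [|[c v] l IH] j // /andP[/= pv pl].
rewrite /blocks_word /= -/(blocks_word l) size_cat => jn jl.
have /andP[/= v0 vK] := possible_block_size (p := (c, v)) pv.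
case: ltnP => [jv|vj]; last first.
  have [||j' j'K] := IH (j - size v)%N pl; first by lia.
    by lia.
  by exists j' => //; rewrite drop_cat ltnNge vj.
exists j; first exact: leq_trans jv vK.
apply: le_trans (window_prob_block n c (v := v) (u' := take (n + j - size v) (blocks_word l)) (ltnW jv) _).
  rewrite opprD expRD expR_block_cost // ler_wpM2l ?divr_ge0 ?(ltW pv) //.
  by apply: prefix_prob_ge => //; lia.
move=> y; rewrite drop_cat jv take_cat size_drop; case: ltnP => [nv _|vn].
  by rewrite -{2}(cat_take_drop n (drop j v)) -catA prefix_prefix.
rewrite prefix_catr // eqxx /=.
by rewrite (_ : n - (size v - j) = n + j - size v)%N //; lia.
Qed.

(** The starting position is uniformly distributed below K ^ m. The second summand
    makes the model positive on words that it would otherwise exclude. *)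
Definition model_prob n u : R :=
  (K ^ m)%:R^-1 * \sum_(0 <= j < (K ^ m)%N) window_prob n.+1 u j + (d.+1%:R ^+ n)^-1.

Lemma model_prob_gt0 n u : 0 < model_prob n u.
Proof.
rewrite ltr_wpDl ?invr_gt0 ?exprn_gt0 ?ltr0n // mulr_ge0 ?invr_ge0 ?ler0n //.
by apply: sumr_ge0 => j _; exact: window_prob_ge0.
Qed.

Lemma sum_model_prob n : \sum_(u <- words d n) model_prob n u <= 2.
Proof.
rewrite big_split /= big_words_const divff ?expf_neq0 ?pnatr_eq0 //.
rewrite (_ : 2 = 1 + 1) // lerD2r -mulr_sumr exchange_big /=.
rewrite ler_pdivrMl ?ltr0n ?expn_gt0 ?maxlen_gt0 // mulr1.
rewrite -[X in _ <= X%:R]subn0 -sumr_const_nat.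
by apply: ler_sum => j _; exact: sum_window_prob_le1.
Qed.

Lemma ln_maxlen_ge0 : 0 <= ln (K ^ m)%:R :> R.
Proof. by rewrite ln_ge0 // ler1n expn_gt0 maxlen_gt0. Qed.

Lemma window_cost_le n l j : possible_blocks l -> (j < size (blocks_word l))%N ->
  window_cost n (fun u => - ln (model_prob n u)) (drop j (blocks_word l)) <=
  ln (K ^ m)%:R + blocks_cost j n l.
Proof.
move=> pl jl; rewrite /window_cost size_drop; case: leqP => [nj|_]; last first.
  by rewrite addr_ge0 ?ln_maxlen_ge0 ?blocks_cost_ge0.
have [|j' j'K jp] := window_prob_ge pl (n := n) (j := j) _ jl; first by lia.
have K0 : 0 < (K ^ m)%:R :> R by rewrite ltr0n expn_gt0 maxlen_gt0.
rewrite lerNl -ler_expR lnK ?posrE ?model_prob_gt0 // opprD expRD expRN lnK ?posrE //.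
rewrite ler_wpDr ?invr_ge0 ?exprn_ge0 // ler_wpM2l ?invr_ge0 ?ler0n //.
apply: (le_trans jp); rewrite big_mkord (bigD1 (Ordinal j'K)) //= lerDl.
by apply: sumr_ge0 => i _; exact: window_prob_ge0.
Qed.

Variable phi : word d -> R.
Hypothesis Hphi : word_frequencies P phi.

Definition block_entropy_of n : R := \sum_(u <- words d n) - (phi u * ln (phi u)).

Definition mean_entropy : R :=
  letter_mean phi (entropy_of_iterate P m) / growth_rate P phi ^+ m.

(** In the iterate k + m, cut into the images of the letters of the iterate k, the
    cost of each block of length b is charged to at most n + b windows. Dividing
    by the length and letting k grow turns the sum over windows into the cross
    entropy of phi relative to the model. *)
Lemma block_entropy_le n : (0 < n)%N -> block_entropy_of n <=
  (n + K ^ m)%:R * (mean_entropy + ln d.+1%:R / growth_rate P phi ^+ m) +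
  (ln (K ^ m)%:R + 2).
Proof.
move=> n0.
pose cost u := - ln (model_prob n u).
have gibbs_sum : block_entropy_of n <= \sum_(u <- words d n) cost u * phi u + 2.
  apply: (@le_trans _ _ (\sum_(u <- words d n) (cost u * phi u + model_prob n u))); last first.
    by rewrite big_split lerD2l sum_model_prob.
  rewrite /block_entropy_of big_seq [leRHS]big_seq; apply: ler_sum => u.
  rewrite mem_words => /eqP un.
  have phi0 : 0 <= phi u by apply: (phi_ge0 Htheta HP Hphi); rewrite -size_eq0 un -lt0n.
  have := gibbs phi0 (ltW (model_prob_gt0 n u)) (fun=> model_prob_gt0 n u).
  by rewrite /cost; lra.
have cost_le k : expect P (k + m) [:: ord0]
    (fun w => \sum_(u <- words d n) cost u * (occ u w)%:R) <=
    ln (K ^ m)%:R * expect P (k + m) [:: ord0] (@len R d) +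
    (n + K ^ m)%:R * expect P k [:: ord0]
      (letter_sum (fun c => ln d.+1%:R + entropy_of_iterate P m c)).
  rewrite !expect_comp -!expectZ -expectD; apply: (ler_expect Htheta HP) => X _.
  rewrite -!(block_expect_word X) -block_expect_cost -!block_expectZ -block_expectD.
  apply: ler_block_expect => l pl; rewrite sum_occ.
  apply: (@le_trans _ _ (\sum_(0 <= j < size (blocks_word l))
    (ln (K ^ m)%:R + blocks_cost j n l))).
    rewrite big_seq [leRHS]big_seq; apply: ler_sum => j; rewrite mem_index_iota => jl.
    exact: window_cost_le.
  rewrite big_split /= sumr_const_nat subn0 -[X in X + _ <= _]mulr_natr lerD2l.
  exact: sum_blocks_cost.
have lam0 := growth_rate_gt0 Htheta HP Hphi.
have lim_cost := sum_freq_cvg Hphi (c := cost) ord0 n0.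
rewrite -(cvg_shiftn m) /= in lim_cost.
have lim_bound : (fun k => ln (K ^ m)%:R + (n + K ^ m)%:R *
    ((expect P k [:: ord0] (letter_sum (fun c => ln d.+1%:R + entropy_of_iterate P m c)) /
      expect P k [:: ord0] (@len R d)) /
     (expect P (k + m) [:: ord0] (@len R d) / expect P k [:: ord0] (@len R d)))) @ \oo -->
   ln (K ^ m)%:R + (n + K ^ m)%:R *
    (letter_mean phi (fun c => ln d.+1%:R + entropy_of_iterate P m c) / growth_rate P phi ^+ m).
  apply: cvgD; first exact: cvg_cst.
  apply: cvgMr; apply: cvgM; first exact: (letter_mean_cvg Hphi).
  apply: cvgV; first by rewrite expf_neq0 // gt_eqF.
  exact: (len_ratio_cvg Htheta HP Hphi).
have cost_mean : \sum_(u <- words d n) cost u * phi u <= ln (K ^ m)%:R + (n + K ^ m)%:R *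
    (letter_mean phi (fun c => ln d.+1%:R + entropy_of_iterate P m c) / growth_rate P phi ^+ m).
  apply: (ler_cvg_to lim_cost lim_bound); near=> k.
  have Nk := expect_len_gt0 Htheta HP k ord0.
  have Nkm := expect_len_gt0 Htheta HP (k + m) ord0.
  set E := expect P k _ (letter_sum _).
  have -> : E / expect P k [:: ord0] (@len R d) /
    (expect P (k + m) [:: ord0] (@len R d) / expect P k [:: ord0] (@len R d)) =
    E / expect P (k + m) [:: ord0] (@len R d) by field; rewrite !gt_eqF.
  rewrite ler_pdivrMr // (le_trans (cost_le k)) // mulrDl lerD2l.
  by rewrite -[leRHS]mulrA divfK ?gt_eqF.
rewrite letter_meanD (letter_mean_cst Htheta HP Hphi) in cost_mean.
apply: (le_trans gibbs_sum); rewrite [leRHS]addrA lerD2r (le_trans cost_mean) // [leLHS]addrC.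
by rewrite lerD2r /mean_entropy [X in _ <= _ * X]addrC mulrDl.
Unshelve. all: by end_near. Qed.

End UpperBound.

(** * The entropy of the iterates is at most the block entropies *)

Section LowerBound.
Variables (R : realType) (d : nat) (theta : 'I_d.+1 -> {fset word d}).
Hypothesis Htheta : is_subst theta.
Variable P : 'rV[R]_(nparams theta).
Hypothesis HP : nondegenerate_data P.
Variable phi : word d -> R.
Hypothesis Hphi : word_frequencies P phi.
Implicit Types (u v w : word d) (k N j l : nat) (a c : 'I_d.+1).

Local Notation K := (maxlen theta).
Local Notation D := (d.+1%:R : R).

Lemma cvg_natr_geometric (x : R) : 1 < x -> (fun k => k%:R / x ^+ k) @ \oo --> (0 : R).
Proof.
(* Bernoulli's inequality for the square root of x beats k quadratically. *)
move=> x1; pose y := Num.sqrt x - 1.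
have y0 : 0 < y by rewrite subr_gt0 -[ltLHS]sqrtr1 ltr_sqrt // (lt_trans ltr01 x1).
have x_ge k : (k%:R * y) ^+ 2 <= x ^+ k.
  rewrite -[x]sqr_sqrtr ?(ltW (lt_trans ltr01 x1)) // -exprM mulnC exprM.
  rewrite lerXn2r ?nnegrE ?exprn_ge0 ?sqrtr_ge0 ?mulr_ge0 ?(ltW y0) //.
  have -> : Num.sqrt x = 1 + y by rewrite addrC subrK.
  elim: k => [|k IH]; first by rewrite mul0r ler01.
  have : 1 <= (1 + y) ^+ k by rewrite exprn_ege1 // lerDl ltW.
  rewrite exprS -natr1; move: ((1 + y) ^+ k) IH => E IH E1.
  have := ler_wpM2l (ltW y0) E1; lra.
apply: (@squeeze_cvgr _ _ _ _ (fun=> 0) (fun k => (y ^+ 2)^-1 * k.+1%:R^-1 *+ 2)).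
- near=> k; rewrite divr_ge0 ?exprn_ge0 ?(ltW (lt_trans ltr01 x1)) //=.
  have k0 : (0 < k)%N by near: k; exact: nbhs_infty_gt.
  rewrite ler_pdivrMr ?exprn_gt0 ?(lt_trans ltr01 x1) //.
  apply: (@le_trans _ _ ((y ^+ 2)^-1 * k.+1%:R^-1 *+ 2 * (k%:R * y) ^+ 2)); last first.
    by rewrite ler_wpM2l ?x_ge // mulrn_wge0 // mulr_ge0 // invr_ge0 exprn_ge0 // ltW.
  rewrite -mulr_natr exprMn [leRHS](_ : _ = k%:R * (2 * k%:R / k.+1%:R)); last first.
    by field; rewrite addrC natr1 pnatr_eq0 /= (gt_eqF y0).
  rewrite [leLHS]mulrC ler_wpM2l // ler_pdivlMr ?ltr0n // mul1r -natrM ler_nat; lia.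
- exact: cvg_cst.
- rewrite -[X in _ --> X](mulr0 ((y ^+ 2)^-1 *+ 2)).
  under eq_fun do rewrite -mulrnAl.
  by apply: cvgMr; exact: cvg_harmonic.
Unshelve. all: by end_near. Qed.

Section Chunks.
Variables (n : nat) (eta : R).
Hypotheses (n0 : (0 < n)%N) (eta0 : 0 < eta).

(** The perturbation makes the model positive on all words, at an arbitrarily small
    cost. *)
Definition chunk_model u : R := (phi u + eta) / (1 + eta * D ^+ n).

Definition chunk_cost u : R := - ln (chunk_model u).

Lemma total_gt0 : 0 < 1 + eta * D ^+ n.
Proof. by rewrite ltr_wpDr // mulr_ge0 ?exprn_ge0 // ltW. Qed.

Lemma phi_words_ge0 u : size u = n -> 0 <= phi u.
Proof. by move=> un; apply: (phi_ge0 Htheta HP Hphi); rewrite -size_eq0 un -lt0n. Qed.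

Lemma chunk_model_gt0 u : size u = n -> 0 < chunk_model u.
Proof. by move=> un; rewrite divr_gt0 ?total_gt0 // ltr_wpDl // phi_words_ge0. Qed.

Lemma sum_chunk_model : \sum_(u <- words d n) chunk_model u <= 1.
Proof.
rewrite -mulr_suml ler_pdivrMr ?total_gt0 // mul1r big_split big_words_const /=.
by rewrite mulrC lerD2r; exact: (sum_phi_le1 Htheta HP Hphi).
Qed.

(** Consecutive chunks are modelled as independent; an incomplete last chunk is
    not charged. *)
Fixpoint chunk_prob N w : R :=
  if N is N'.+1 then
    (if (n <= size w)%N then chunk_model (take n w) else 1) * chunk_prob N' (drop n w)
  else 1.

Lemma chunk_prob_gt0 N w : 0 < chunk_prob N w.
Proof.
elim: N w => //= N IH w; rewrite mulr_gt0 //; case: ifP => // nw.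
by rewrite chunk_model_gt0 // size_takel.
Qed.

Lemma ln_chunk_prob N w : - ln (chunk_prob N w) =
  \sum_(0 <= i < N) window_cost n chunk_cost (drop (i * n) w).
Proof.
elim: N w => [|N IH] w; first by rewrite big_geq //= ln1 oppr0.
rewrite big_nat_recl // mul0n drop0 /= lnM ?posrE ?chunk_prob_gt0 //; last first.
  by case: ifP => // nw; rewrite chunk_model_gt0 // size_takel.
rewrite opprD IH; congr (_ + _).
  by rewrite /window_cost; case: ifP; rewrite // ln1 oppr0.
by apply: eq_bigr => i _; rewrite drop_drop mulSn addnC.
Qed.

Lemma chunk_prob_short N w : (size w < n)%N -> chunk_prob N w = 1.
Proof.
elim: N w => //= N IH w wn; rewrite leqNgt wn mul1r IH //.
by rewrite size_drop (leq_ltn_trans (leq_subr _ _)).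
Qed.

(** The mass may exceed one only because the last, incomplete chunk is not
    charged. *)
Lemma sum_chunk_prob N l : (l <= N)%N -> \sum_(w <- words d l) chunk_prob N w <= D ^+ n.
Proof.
have D1 : 1 <= D by rewrite ler1n.
elim: N l => [|N IH] l.
  by rewrite leqn0 => /eqP ->; rewrite big_words0 exprn_ege1.
move=> lN; case: (ltnP l n) => [ln|nl].
  rewrite big_seq (eq_bigr (fun=> 1)) => [|w]; last first.
    by rewrite mem_words => /eqP wl; rewrite chunk_prob_short ?wl.
  by rewrite -big_seq big_words_const mulr1 ler_weXn2l // ltnW.
rewrite -(subnKC nl) big_words_cat.
apply: (@le_trans _ _ (\sum_(x <- words d n) chunk_model x * D ^+ n)); last first.
  rewrite -mulr_suml -[leRHS]mul1r ler_wpM2r ?exprn_ge0 //; exact: sum_chunk_model.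
rewrite big_seq [leRHS]big_seq; apply: ler_sum => x; rewrite mem_words => /eqP xn.
apply: (@le_trans _ _ (\sum_(y <- words d (l - n)) chunk_model x * chunk_prob N y)).
  rewrite big_seq [leRHS]big_seq; apply: ler_sum => y; rewrite mem_words => /eqP yl.
  by rewrite /= size_cat xn leq_addr take_size_cat // drop_size_cat.
rewrite -mulr_sumr ler_wpM2l ?(ltW (chunk_model_gt0 xn)) // IH //; lia.
Qed.

Lemma sum_chunk_prob_drop j l : (j < n)%N ->
  \sum_(w <- words d l) chunk_prob l (drop j w) <= D ^+ (n + n).
Proof.
have D1 : 1 <= D by rewrite ler1n.
move=> jn; case: (leqP j l) => [jl|lj].
  rewrite -{1}(subnKC jl) big_words_cat.
  apply: (@le_trans _ _ (\sum_(x <- words d j) D ^+ n)).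
    rewrite big_seq [leRHS]big_seq; apply: ler_sum => x; rewrite mem_words => /eqP xj.
    apply: (@le_trans _ _ (\sum_(y <- words d (l - j)) chunk_prob l y)).
      by apply: ler_sum => y _; rewrite drop_size_cat.
    by rewrite sum_chunk_prob // leq_subr.
  by rewrite big_words_const -exprD ler_weXn2l // leq_add2r ltnW.
rewrite big_seq (eq_bigr (fun=> 1)) => [|w]; last first.
  rewrite mem_words => /eqP wl; rewrite chunk_prob_short // size_drop wl.
  by rewrite (leq_ltn_trans (leq_subr _ _)) // (ltn_trans lj).
rewrite -big_seq big_words_const mulr1 ler_weXn2l //; lia.
Qed.

(** Every window of length n is a chunk for exactly one of the n ways of cutting
    a word into chunks. *)
Lemma sum_chunk_offsets w :
  \sum_(0 <= j < n) - ln (chunk_prob (size w) (drop j w)) =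
  \sum_(u <- words d n) chunk_cost u * (occ u w)%:R.
Proof.
rewrite sum_occ.
transitivity (\sum_(0 <= p < size w * n) window_cost n chunk_cost (drop p w)).
  under eq_bigr do rewrite ln_chunk_prob.
  rewrite exchange_big /=; elim: (size w) => [|N IH]; first by rewrite !big_geq.
  rewrite big_nat_recr //= IH mulSn addnC sum_nat_add; congr (_ + _).
  by apply: eq_bigr => j _; rewrite drop_drop.
have /subnKC <- : (size w <= size w * n)%N by rewrite leq_pmulr.
rewrite sum_nat_add [X in _ + X]big1 ?addr0 // => p _.
by rewrite drop_oversize ?leq_addr // /window_cost leqNgt n0.
Qed.

(** A bound for the mass of the chunk model on all words that can be realised in k
    steps, for any offset. *)
Definition chunk_total k : R := (K ^ k).+1%:R * D ^+ (n + n).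

Lemma chunk_total_gt0 k : 0 < chunk_total k.
Proof. by rewrite mulr_gt0 ?exprn_gt0 ?ltr0n. Qed.

(** The inequality of Gibbs for the chunk models with the n different offsets,
    added up. *)
Lemma entropy_le_chunks k a : n%:R * entropy_of_iterate P k a <=
  expect P k [:: a] (fun w => \sum_(u <- words d n) chunk_cost u * (occ u w)%:R) +
  n%:R * ln (chunk_total k).
Proof.
have offset j : (j < n)%N -> entropy_of_iterate P k a <=
    expect P k [:: a] (fun w => - ln (chunk_prob (size w) (drop j w))) + ln (chunk_total k).
  move=> jn; rewrite -[X in _ + X](expect_cst HP k [:: a]) -expectD -subr_le0 -expectB.
  have T0 := chunk_total_gt0 k.
  rewrite (expect_sum_pr Htheta HP _ (leqnn _)) muln1.
  apply: (@le_trans _ _ (\sum_(w <- words_upto d (K ^ k))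
     (chunk_prob (size w) (drop j w) / chunk_total k - pr P k [:: a] w))).
    apply: ler_sum => w _; have q0 := chunk_prob_gt0 (size w) (drop j w).
    have q0' : 0 < chunk_prob (size w) (drop j w) / chunk_total k by rewrite divr_gt0.
    apply: le_trans (gibbs (pr_ge0 Htheta HP k [:: a] w) (ltW q0') (fun=> q0')).
    rewrite ln_div ?posrE // le_eqVlt; apply/orP; left; apply/eqP; ring.
  rewrite sumrB subr_le0 -mulr_suml ler_pdivrMr //.
  have -> : \sum_(w <- words_upto d (K ^ k)) pr P k [:: a] w = 1.
    rewrite -[RHS](expect_cst HP k [:: a]) (expect_sum_pr Htheta HP (fun=> 1) (leqnn _)).
    by rewrite muln1; apply: eq_bigr => w _; rewrite mulr1.
  rewrite mul1r big_words_upto /chunk_total -[X in X%:R]subn0 mulr_natl -sumr_const_nat.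
  apply: ler_sum => l _; apply: le_trans (sum_chunk_prob_drop l jn).
  by rewrite big_seq [leRHS]big_seq; apply: ler_sum => w; rewrite mem_words => /eqP ->.
rewrite -(eq_expect P k [:: a] sum_chunk_offsets) expect_sum !mulr_natl.
rewrite -[X in X *+ n]/(entropy_of_iterate P k a) -[n in leLHS]subn0 -[n in X in _ + X]subn0.
rewrite -!sumr_const_nat -big_split big_seq [leRHS]big_seq.
by apply: ler_sum => j; rewrite mem_index_iota => /= jn; exact: offset.
Qed.

End Chunks.
End LowerBound.

(** * Entropy as the limit of the entropies of the iterates *)

Section Limit.
Variables (R : realType) (d : nat) (theta : 'I_d.+1 -> {fset word d}).
Hypothesis Htheta : is_subst theta.
Variable P : 'rV[R]_(nparams theta).
Hypothesis HP : nondegenerate_data P.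
Variable phi : word d -> R.
Hypothesis Hphi : word_frequencies P phi.
Implicit Types (u v w : word d) (k m n : nat) (a c : 'I_d.+1).

Local Notation K := (maxlen theta).
Local Notation D := (d.+1%:R : R).
Local Notation lam := (growth_rate P phi).
Local Notation L m := (mean_entropy P m phi).

Hypothesis lam_gt1 : 1 < lam.

Lemma cst_geometric_cvg0 (x : R) : (fun k => x / lam ^+ k) @ \oo --> (0 : R).
Proof.
have -> : (fun k => x / lam ^+ k) = geometric x lam^-1.
  by apply/funext => k; rewrite /= exprVn.
apply: cvg_geometric; rewrite ger0_norm ?invr_ge0 ?(ltW (lt_trans ltr01 lam_gt1)) //.
by rewrite invf_lt1 // (lt_trans ltr01 lam_gt1).
Qed.

Lemma linear_geometric_cvg0 (x y : R) :
  (fun k => (x + k%:R * y) / lam ^+ k) @ \oo --> (0 : R).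
Proof.
rewrite -[X in _ --> X]addr0; under eq_fun do rewrite mulrDl.
apply: cvgD; first exact: cst_geometric_cvg0.
rewrite -[X in _ --> X](mulr0 y); under eq_fun do rewrite mulrAC mulrC.
by apply: cvgMr; exact: cvg_natr_geometric.
Qed.

Lemma sum_chunk_cost_le n eta : (0 < n)%N -> 0 < eta ->
  \sum_(u <- words d n) chunk_cost phi n eta u * phi u <=
  block_entropy_of phi n + eta * D ^+ n.
Proof.
move=> n0 eta0; have T0 := total_gt0 d n eta0.
apply: (@le_trans _ _ (\sum_(u <- words d n)
   (- (phi u * ln (phi u)) + ln (1 + eta * D ^+ n) * phi u))).
  rewrite big_seq [leRHS]big_seq; apply: ler_sum => u; rewrite mem_words => /eqP un.
  have phi0 := phi_words_ge0 Htheta HP Hphi n0 un.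
  have phi_eta0 : 0 < phi u + eta by rewrite ltr_wpDl.
  rewrite /chunk_cost /chunk_model ln_div ?posrE //.
  have : phi u * ln (phi u) <= phi u * ln (phi u + eta).
    move: phi0; rewrite le_eqVlt => /predU1P[<-|phi0]; first by rewrite !mul0r.
    by rewrite ler_pM2l // ler_ln ?posrE ?lerDl ?ltW // ltr_wpDl // ltW.
  by lra.
rewrite big_split lerD2l /= -mulr_sumr.
have c0 : 0 <= eta * D ^+ n by rewrite mulr_ge0 ?exprn_ge0 // ltW.
apply: (@le_trans _ _ (ln (1 + eta * D ^+ n))); last first.
  by apply: le_ln1Dx; apply: lt_le_trans c0; rewrite oppr_lt0.
rewrite ler_piMr ?ln_ge0 ?lerDl //; exact: (sum_phi_le1 Htheta HP Hphi).
Qed.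

(** The perturbation eta, the convergence of the frequencies and the constant
    chunk_total each contribute a third of eps. *)
Lemma mean_entropy_le n (eps : R) : (0 < n)%N -> 0 < eps ->
  \forall k \near \oo, L k <= block_entropy_of phi n / n%:R + eps.
Proof.
move=> n0 eps0; pose eta := eps / 3 / D ^+ n.
have Dn0 : 0 < D ^+ n by rewrite exprn_gt0.
have nR0 : 0 < n%:R :> R by rewrite ltr0n.
have eta0 : 0 < eta by rewrite !divr_gt0.
have eps30 : 0 < eps / 3 by rewrite divr_gt0.
pose S := \sum_(u <- words d n) chunk_cost phi n eta u * phi u.
have S_le : S <= block_entropy_of phi n + eps / 3.
  by apply: le_trans (sum_chunk_cost_le n0 eta0) _; rewrite divfK ?gt_eqF.
pose E k a := expect P k [:: a]
  (fun w => \sum_(u <- words d n) chunk_cost phi n eta u * (occ u w)%:R).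
have E_le : \forall k \near \oo, forall a, E k a <= (S + eps / 3) * expect P k [:: a] (@len R d).
  apply: filter_forall => a.
  have lim_a := sum_freq_cvg Hphi (c := chunk_cost phi n eta) a n0.
  have le_a : \forall k \near \oo, E k a / expect P k [:: a] (@len R d) <= S + eps / 3.
    by move/cvgr_le: lim_a; apply; rewrite ltrDl.
  by near=> k; rewrite -ler_pdivrMr ?(expect_len_gt0 Htheta HP) //; near: k.
have T_cvg : (fun k => ln (chunk_total R theta n k) / lam ^+ k) @ \oo --> (0 : R).
  have K0 k : 0 < (K ^ k)%:R :> R by rewrite ltr0n expn_gt0 maxlen_gt0.
  apply: (@squeeze_cvgr _ _ _ _ (fun=> 0)
    (fun k => ((ln 2 + ln (D ^+ (n + n))) + k%:R * ln K%:R) / lam ^+ k)).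
  - near=> k; rewrite divr_ge0 ?exprn_ge0 ?(ltW (lt_trans ltr01 lam_gt1)) //=; last first.
      by rewrite ln_ge0 // mulr_ege1 ?ler1n // exprn_ege1 // ler1n.
    rewrite ler_wpM2r ?invr_ge0 ?exprn_ge0 ?(ltW (lt_trans ltr01 lam_gt1)) //.
    rewrite /chunk_total lnM ?posrE ?exprn_gt0 ?ltr0n // addrAC lerD2r.
    rewrite mulr_natl -lnXn ?ltr0n ?maxlen_gt0 // -natrX -lnM ?posrE //.
    rewrite ler_ln ?posrE ?mulr_gt0 ?ltr0n ?expn_gt0 ?maxlen_gt0 //.
    by rewrite mulr_natl mulr2n -natr1 lerD2l ler1n expn_gt0 maxlen_gt0.
  - exact: cvg_cst.
  - exact: linear_geometric_cvg0.
near=> k.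
have lamk0 : 0 < lam ^+ k by rewrite exprn_gt0 // (lt_trans ltr01 lam_gt1).
have T_le : ln (chunk_total R theta n k) / lam ^+ k <= eps / 3.
  by near: k; move/cvgr_le: T_cvg; apply.
have entropy_le a : n%:R * entropy_of_iterate P k a <=
    (S + eps / 3) * expect P k [:: a] (@len R d) + n%:R * ln (chunk_total R theta n k).
  apply: le_trans (entropy_le_chunks Htheta HP Hphi n0 eta0 k a) _.
  by rewrite lerD2r; move: a; near: k.
have := ler_letter_mean Htheta HP Hphi entropy_le.
rewrite letter_meanD !letter_meanZ (letter_mean_cst Htheta HP Hphi).
rewrite (letter_mean_len Htheta HP Hphi) => mean_le.
rewrite /mean_entropy ler_pdivrMr //.
have {}T_le : ln (chunk_total R theta n k) <= eps / 3 * lam ^+ k by rewrite -ler_pdivrMr.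
rewrite -(ler_pM2l nR0) (le_trans mean_le) //.
apply: (@le_trans _ _ ((S + eps / 3) * lam ^+ k + n%:R * (eps / 3 * lam ^+ k))).
  by rewrite lerD2l ler_wpM2l.
have -> : n%:R * ((block_entropy_of phi n / n%:R + eps) * lam ^+ k) =
    (block_entropy_of phi n + n%:R * eps) * lam ^+ k by field; rewrite gt_eqF.
rewrite mulrA -mulrDl ler_wpM2r ?(ltW lamk0) //.
have n1 : 1 <= n%:R :> R by rewrite ler1n.
have := ler_wpM2r (ltW eps30) n1; rewrite mul1r; lra.
Unshelve. all: by end_near. Qed.

Lemma lam_exp_gt0 k : 0 < lam ^+ k.
Proof. by rewrite exprn_gt0 // (lt_trans ltr01 lam_gt1). Qed.

Lemma block_entropy_over_n_le m (eps : R) : 0 < eps ->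
  \forall n \near \oo, block_entropy_of phi n / n%:R <= L m + ln D / lam ^+ m + eps.
Proof.
move=> eps0; set X := L m + _.
have bound_cvg : (fun n => X + ((K ^ m)%:R * X + (ln (K ^ m)%:R + 2)) * n%:R^-1) @ \oo --> X.
  rewrite -[X in _ --> X]addr0; apply: cvgD; first exact: cvg_cst.
  rewrite -[X in _ --> X](mulr0 ((K ^ m)%:R * X + (ln (K ^ m)%:R + 2))).
  apply: cvgMr; rewrite -(cvg_shiftS _ _) /=; exact: cvg_harmonic.
near=> n.
have n0 : (0 < n)%N by near: n; exact: nbhs_infty_gt.
have nR0 : 0 < n%:R :> R by rewrite ltr0n.
apply: (@le_trans _ _ (X + ((K ^ m)%:R * X + (ln (K ^ m)%:R + 2)) * n%:R^-1)); last first.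
  by near: n; move/cvgr_le: bound_cvg; apply; rewrite ltrDl.
rewrite ler_pdivrMr // mulrDl divfK ?gt_eqF //.
have := block_entropy_le Htheta HP m Hphi n0.
by rewrite -/X natrD mulrDl; lra.
Unshelve. all: by end_near. Qed.

Lemma block_entropy_ge0 n : (0 < n)%N -> 0 <= block_entropy_of phi n.
Proof.
move=> n0; rewrite /block_entropy_of big_seq sumr_ge0 // => u.
rewrite mem_words => /eqP un; have phi0 := phi_words_ge0 Htheta HP Hphi n0.
rewrite oppr_ge0 mulr_ge0_le0 ?phi0 // ln_le0 //.
apply: le_trans (sum_phi_le1 Htheta HP Hphi n0).
rewrite (bigD1_seq u) ?mem_words ?un ?words_uniq //= lerDl big_seq_cond sumr_ge0 // => v.
by rewrite mem_words => /andP[/eqP vn _]; exact: phi0.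
Qed.

(** The limit is the infimum of the block entropies per letter. By mean_entropy_le
    it bounds the limit superior of L from above, and by block_entropy_over_n_le
    block entropies are, for each m, eventually below L m up to an error that
    vanishes with m. *)
Lemma entropy_limit : exists h : R,
  [/\ (fun n => block_entropy_of phi n / n%:R) @ \oo --> h,
      (fun m => L m) @ \oo --> h & forall m, h <= L m + ln D / lam ^+ m].
Proof.
pose b n := block_entropy_of phi n / n%:R.
pose A : set R := [set b n | n in [set n | (0 < n)%N]].
have A_inf : has_inf A.
  split; first by exists (b 1%N), 1%N.
  exists 0 => _ [n /= n0 <-]; rewrite divr_ge0 ?ler0n //.
  exact: block_entropy_ge0.
have h_le n : (0 < n)%N -> inf A <= b n.
  by move=> n0; apply: ge_inf; [exact: A_inf.2|exists n].
have h_bound m : inf A <= L m + ln D / lam ^+ m.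
  apply/ler_addgt0Pr => eps eps0.
  have [n /andP[n0 bn]] : exists n, (0 < n)%N && (b n <= L m + ln D / lam ^+ m + eps).
    near \oo => n; exists n; apply/andP; split; first by near: n; exact: nbhs_infty_gt.
    by near: n; exact: block_entropy_over_n_le.
  exact: le_trans (h_le n n0) bn.
have L_le eps : 0 < eps -> \forall m \near \oo, L m <= inf A + eps.
  move=> eps0; have eps20 : 0 < eps / 2 by rewrite divr_gt0.
  have [_ [n n0 <-] bn] := inf_adherent eps20 A_inf.
  near=> m; have -> : inf A + eps = inf A + eps / 2 + eps / 2 by rewrite -addrA -splitr.
  apply: (@le_trans _ _ (b n + eps / 2)); last by rewrite lerD2r ltW.
  by near: m; exact: mean_entropy_le.
have g_cvg := cst_geometric_cvg0 (ln D).
have g_le eps : 0 < eps -> \forall m \near \oo, ln D / lam ^+ m <= eps.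
  by move=> eps0; move/cvgr_le: g_cvg; apply.
exists (inf A); split => //; apply/cvgrPdist_le => eps eps0.
- have eps30 : 0 < eps / 3 by rewrite divr_gt0.
  have [m /andP[Lm gm]] : exists m, (L m <= inf A + eps / 3) && (ln D / lam ^+ m <= eps / 3).
    by near \oo => m; exists m; apply/andP; split; near: m; [exact: L_le|exact: g_le].
  near=> n; rewrite distrC ger0_norm ?subr_ge0; last first.
    by apply: h_le; near: n; exact: nbhs_infty_gt.
  have : b n <= L m + ln D / lam ^+ m + eps / 3.
    by near: n; exact: block_entropy_over_n_le.
  by rewrite /b; lra.
- near=> m; rewrite ler_distlC.
  have : ln D / lam ^+ m <= eps by near: m; exact: g_le.
  have : L m <= inf A + eps by near: m; exact: L_le.
  have := h_bound m; lra.
Unshelve. all: by end_near. Qed.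

(** The case k -> oo of entropy_increment_le, averaged over the letters and divided
    by lam ^+ (k + m). *)
Lemma entropy_limit_ge (h : R) m : (fun k => L k) @ \oo --> h ->
  lam * L m.+1 - L m - (ln D + m.+1%:R * ln K%:R) / lam ^+ m <= (lam - 1) * h.
Proof.
move=> Lh.
have L_increment k : L (k + m) - lam * L (k + m).+1 <=
    L m - lam * L m.+1 + (ln D + m.+1%:R * ln K%:R) / lam ^+ m.
  have := ler_letter_mean Htheta HP Hphi (entropy_increment_le Htheta HP m k).
  rewrite (letter_mean_expect Htheta HP Hphi) !letter_meanB (letter_mean_cst Htheta HP Hphi).
  rewrite /mean_entropy -addnS !exprD !exprS.
  have lnw : ln (block_weight R theta m) = - (ln D + m.+1%:R * ln K%:R).
    rewrite lnV ?posrE ?ltr0n ?muln_gt0 ?expn_gt0 ?maxlen_gt0 //; congr (- _).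
    rewrite natrM lnM ?posrE ?ltr0n ?expn_gt0 ?maxlen_gt0 //.
    by rewrite natrX lnXn ?ltr0n ?maxlen_gt0 // mulr_natl.
  rewrite lnw opprK.
  set e := letter_mean phi (entropy_of_iterate P m).
  set e1 := letter_mean phi (entropy_of_iterate P m.+1).
  set ek := letter_mean phi (entropy_of_iterate P (k + m)).
  set ek1 := letter_mean phi (entropy_of_iterate P (k + m.+1)).
  set kappa := ln D + _.
  have lam0 : lam != 0 by rewrite gt_eqF // (lt_trans ltr01 lam_gt1).
  have lamk0 := lam_exp_gt0 k; have lamm0 := lam_exp_gt0 m.
  move: (lam ^+ k) (lam ^+ m) lamk0 lamm0 => x y x0 y0 ineq.
  have -> : ek / (x * y) - lam * (ek1 / (x * (lam * y))) = (ek - ek1) / (x * y).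
    by field; rewrite lam0 !gt_eqF.
  have -> : e / y - lam * (e1 / (lam * y)) + kappa / y = x * (e - e1 + kappa) / (x * y).
    by field; rewrite lam0 !gt_eqF.
  by rewrite ler_wpM2r // invr_ge0 mulr_ge0 ?ltW.
have Lm_cvg : (fun k => L (k + m)) @ \oo --> h.
  by move: (Lh); rewrite -(cvg_shiftn m).
have Lm1_cvg : (fun k => L (k + m).+1) @ \oo --> h.
  under eq_fun do rewrite -addnS.
  by move: (Lh); rewrite -(cvg_shiftn m.+1).
have diff_cvg : (fun k => L (k + m) - lam * L (k + m).+1) @ \oo --> h - lam * h.
  by apply: cvgB => //; exact: cvgMr.
have : h - lam * h <= L m - lam * L m.+1 + (ln D + m.+1%:R * ln K%:R) / lam ^+ m.
  by move/cvgr_to_le: diff_cvg; apply; exact: nearW.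
lra.
Qed.

End Limit.

(** * From the frequency measure to frequencies *)

Section FrequencyMeasure.
Variables (R : realType) (d : nat) (theta : 'I_d.+1 -> {fset word d}).
Hypothesis Htheta : is_subst theta.
Variable P : 'rV[R]_(nparams theta).
Hypothesis HP : nondegenerate_data P.
Variable mu : probability (full_shift d) R.
Hypothesis Hmu : is_frequency_measure P mu.
Implicit Types (u v w : word d) (n m k : nat) (a c : 'I_d.+1).

(** Extending by zero outside the language makes the limit formula hold for all
    non-empty words. *)
Definition frequency_of u : R :=
  if `[< language P u >] then fine (mu (cylinder P u)) else 0.

Lemma occ_gt0_infix u w : (0 < occ u w)%N -> infix u w.
Proof.
rewrite -has_count => /hasP[i _ /prefixP[s ws]]; apply/infixP.
by exists (take i w), s; rewrite -ws cat_take_drop.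
Qed.

Lemma frequency_ofP : word_frequencies P frequency_of.
Proof.
move=> u a u0; rewrite /frequency_of; case: asboolP => [Lu|NLu].
  have [_ _ /(_ u a Lu)] := Hmu; apply: cvg_trans; apply: near_eq_cvg; near=> k.
  by rewrite !(subst_expectationE Htheta HP).
apply: (@cvg_trans _ ((fun=> 0 : R) @ \oo)); last exact: cvg_cst.
apply: near_eq_cvg; near=> k.
rewrite (eq_expect_supp Htheta HP (g := fun=> 0)) ?(expect_cst HP) ?mul0r // => w pw.
apply/eqP; rewrite pnatr_eq0 -leqn0 leqNgt; apply/negP => /occ_gt0_infix uw.
apply: NLu; split => //; exists a, k, w; split => //.
  by near: k; exact: nbhs_infty_gt.
by rewrite /realisations /= (iter_probE Htheta HP).
Unshelve. all: by end_near. Qed.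

Lemma block_entropyE n : block_entropy P mu n = block_entropy_of frequency_of n.
Proof.
rewrite /block_entropy_of -big_words_tuple /block_entropy big_mkcond.
by apply: eq_bigr => u _; rewrite /frequency_of; case: ifP; rewrite // mul0r oppr0.
Qed.

Lemma entropyE (h : R) :
  (fun n => block_entropy_of frequency_of n / n%:R) @ \oo --> h -> entropy P mu = h.
Proof.
move=> bh; rewrite /entropy; under eq_fun do rewrite block_entropyE.
exact: cvg_lim bh.
Qed.

End FrequencyMeasure.

(** * Primitive substitutions grow *)

Section Growth.
Variables (R : realType) (d : nat) (theta : 'I_d.+1 -> {fset word d}).
Hypothesis Htheta : is_subst theta.
Implicit Types (P Q : 'rV[R]_(nparams theta)) (u v w : word d) (n k : nat) (a c : 'I_d.+1).

(** Which words are possible does not depend on the probabilities. *)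
Lemma expect_gt0_transfer P Q n u (f g : word d -> R) :
  nondegenerate_data P -> nondegenerate_data Q ->
  (forall w, 0 <= f w) -> (forall w, 0 <= g w) -> (forall w, 0 < f w -> 0 < g w) ->
  0 < expect P n u f -> 0 < expect Q n u g.
Proof.
move=> HP HQ.
have step f' g' w : (forall w, 0 <= f' w) -> (forall w, 0 <= g' w) ->
    (forall w, 0 < f' w -> 0 < g' w) ->
    0 < step_expect P w f' -> 0 < step_expect Q w g'.
  elim: w f' g' => [|a w IH] f' g' f0 g0 fg /=; first exact: fg.
  move=> sum0; have [s Ps] : exists s : theta a,
      0 < param P s * step_expect P w (fun v => f' (val s ++ v)).
    apply/not_existsP => H; move: sum0; apply/negP; rewrite -leNgt sumr_le0 // => s _.
    by rewrite leNgt; exact/negP/H.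
  rewrite (bigD1 s) //= ltr_wpDr //.
    apply: sumr_ge0 => t _; apply: mulr_ge0; first exact/ltW/(param_gt0 HQ).
    exact: (expect_ge0 Htheta HQ 1).
  rewrite mulr_gt0 ?(param_gt0 HQ) // (IH (fun v => f' (val s ++ v))) //.
    by move=> v; exact: fg.
  by move: Ps; rewrite pmulr_rgt0 ?(param_gt0 HP).
elim: n f g => [|n IH] f g f0 g0 fg /=; first exact: fg.
apply: IH => w; [exact: (expect_ge0 Htheta HP 1)|exact: (expect_ge0 Htheta HQ 1)|].
exact: step.
Qed.

Lemma subst_matrixE P (HP : nondegenerate_data P) k (f : 'I_d.+1 -> R) a :
  ((\row_i f i) *m subst_matrix P ^+ k) 0 a = expect P k [:: a] (letter_sum f).
Proof.
elim: k f => [|k IH] f; first by rewrite expr0 mulmx1 mxE /= /letter_sum big_seq1.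
rewrite exprS -mulmxE mulmxA.
have -> : (\row_i f i) *m subst_matrix P = \row_j expect P 1 [:: j] (letter_sum f).
  apply/rowP => j; rewrite !mxE (eq_expect P 1 _ (letter_sum_occ f)) expect_sum.
  by apply: eq_bigr => i _; rewrite !mxE (subst_expectationE Htheta HP) expectZ.
rewrite IH -(addn1 k) expect_comp; apply: eq_expect => w.
by rewrite (expect_letter_sum Htheta HP).
Qed.

(** If all images were single letters, the columns of the substitution matrix
    would sum to one and no eigenvalue could exceed one. *)
Lemma exists_long_image P : nondegenerate_data P -> primitive_subst P ->
  exists c (s : theta c), (1 < size (val s))%N.
Proof.
move=> HP [_ [lambda [[/eigenvalueP[v vM v0] _] lambda1]]].
apply/not_existsP => short.
have len1 j : expect P 1 [:: j] (@len R d) = 1.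
  rewrite -[RHS](sum_param HP j) /=; apply: eq_bigr => s _.
  have := short j; rewrite -[X in _ * X]/(len R (val s ++ [::])) cats0 => /forallNP/(_ s).
  move=> /negP; rewrite -leqNgt /len => s1.
  have -> : size (val s) = 1%N by apply/eqP; rewrite eqn_leq s1 size_image_gt0.
  by rewrite mulr1.
case: (@Order.TotalTheory.arg_maxP _ _ _ ord0 xpredT (fun i => `|v 0 i|) isT) => j _ jmax.
have vj : lambda * v 0 j = expect P 1 [:: j] (letter_sum (v 0)).
  rewrite -(subst_matrixE HP) expr1; move/rowP/(_ j): vM; rewrite [in RHS]mxE => <-.
  by congr ((_ *m _) 0 j); apply/rowP => i; rewrite mxE.
have ub w : `|letter_sum (v 0) w| <= `|v 0 j| * len R w.
  apply: le_trans (ler_norm_sum _ _ _) _; rewrite -letter_sum_len /letter_sum mulr_sumr.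
  by apply: ler_sum => i _; rewrite mulr1; exact: jmax.
have vj_le : `|lambda * v 0 j| <= `|v 0 j|.
  rewrite vj -[leRHS]mulr1 -(len1 j) -expectZ ler_norml -expectN.
  by apply/andP; split; apply: (ler_expect Htheta HP (n := 1)) => w _;
    have := ub w; rewrite ler_norml => /andP[].
have : `|v 0 j| <= 0.
  have lambda0 : 0 < lambda by rewrite (lt_trans ltr01).
  rewrite leNgt; apply/negP => vj_gt0.
  by move: vj_le; rewrite normrM (gtr0_norm lambda0) ger_pMl // leNgt lambda1.
move=> vj0; move/eqP: v0; apply; apply/rowP => i; rewrite mxE; apply/eqP.
by rewrite -normr_le0; exact: le_trans (jmax i isT) vj0.
Qed.

(** Some letter c has an image of length at least two, and c has positive frequency
    because some power of the substitution matrix is positive; hence the mean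
    length of an image exceeds one. *)
Lemma growth_rate_gt1 P Q phi : nondegenerate_data P -> primitive_subst P ->
  nondegenerate_data Q -> word_frequencies Q phi -> 1 < growth_rate Q phi.
Proof.
move=> HP Pprim HQ Hphi; have [c [s s1]] := exists_long_image HP Pprim.
have [[_ [k [_ Mk]]] _] := Pprim.
pose letter b : 'I_d.+1 -> R := fun i => (i == b)%:R.
have letter_ge0 w : 0 <= letter_sum (letter c) w.
  by apply: sumr_ge0 => i _; rewrite ler0n.
have phic : 0 < phi [:: c].
  have [a phia] : exists a, 0 < phi [:: a].
    apply/not_existsP => H; have := letter_mean1 Htheta HQ Hphi => /eqP.
    rewrite eq_le => /andP[_]; apply/negP; rewrite -ltNge (le_lt_trans _ ltr01) //.
    by apply: sumr_le0 => a _; rewrite mulr1 leNgt; exact/negP/H.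
  have lamk0 : 0 < growth_rate Q phi ^+ k by rewrite exprn_gt0 // (growth_rate_gt0 Htheta HQ).
  rewrite -(pmulr_rgt0 _ lamk0).
  have -> : phi [:: c] = letter_mean phi (letter c).
    rewrite /letter_mean (bigD1 c) //= /letter eqxx mulr1 big1 ?addr0 // => i /negbTE ->.
    by rewrite mulr0.
  rewrite -(letter_mean_expect Htheta HQ Hphi) /letter_mean (bigD1 a) //= ltr_wpDr //.
    apply: sumr_ge0 => i _; rewrite mulr_ge0 ?(phi_ge0 Htheta HQ Hphi) //.
    exact: (expect_ge0 Htheta HQ).
  rewrite mulr_gt0 //.
  apply: (@expect_gt0_transfer P Q k [:: a] (letter_sum (letter c))) => //.
  rewrite -(subst_matrixE HP); have -> : \row_i letter c i = delta_mx 0 c.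
    by apply/rowP => i; rewrite !mxE eqxx.
  by rewrite -rowE mxE.
rewrite -subr_gt0 -(letter_mean1 Htheta HQ Hphi) /growth_rate -letter_meanB.
have expect_ge i : 0 <= expect Q 1 [:: i] (@len R d) - 1.
  by rewrite subr_ge0; exact: expect_len_ge1.
rewrite /letter_mean (bigD1 c) //= ltr_wpDr //.
  by apply: sumr_ge0 => i _; apply: mulr_ge0; [exact: (phi_ge0 Htheta HQ Hphi)|exact: expect_ge].
rewrite mulr_gt0 // -(sum_param HQ c) -sumrB.
under eq_bigr do rewrite -[X in _ - X]mulr1 -mulrBr.
have len_ge (t : theta c) : 1 <= len R (val t ++ [::]).
  by rewrite cats0 /len ler1n size_image_gt0.
rewrite (bigD1 s) //= ltr_wpDr //.
  apply: sumr_ge0 => t _; rewrite mulr_ge0 ?(ltW (param_gt0 HQ t)) // subr_ge0.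
  exact: len_ge.
by rewrite mulr_gt0 ?(param_gt0 HQ) // subr_gt0 cats0 /len ltr1n.
Qed.

End Growth.

(** * Continuity in the probabilities *)

Section XLnX.
Variable R : realType.

(** Continuity of x ln x at 0, where the logarithm itself is not continuous. *)
Lemma xlnx_le_sqrt (x : R) : x <= 1 -> `|x * ln x| <= 2 * Num.sqrt x.
Proof.
move=> x1; case: (leP x 0) => [x0|x0].
  by rewrite ln0 // mulr0 normr0 mulr_ge0 ?sqrtr_ge0.
have s0 : 0 < Num.sqrt x by rewrite sqrtr_gt0.
have xs : x = Num.sqrt x ^+ 2 by rewrite sqr_sqrtr // ltW.
rewrite ler0_norm ?(mulr_ge0_le0 (ltW x0)) ?ln_le0 //.
rewrite -mulrN -lnV ?posrE // {2}xs -exprVn lnXn ?invr_gt0 //.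
have ln_le : ln (Num.sqrt x)^-1 <= (Num.sqrt x)^-1.
  by rewrite ltW // ln_sublinear // invr_gt0.
rewrite -[ln _ *+ 2]mulr_natl mulrCA ler_pM2l //; apply: le_trans (ler_wpM2l (ltW x0) ln_le) _.
by rewrite {1}xs expr2 mulfK // gt_eqF.
Qed.

Lemma cvg_xlnx (T : Type) (F : set_system T) {FF : Filter F} (g : T -> R) (x : R) :
  0 <= x -> g @ F --> x -> (fun t => g t * ln (g t)) @ F --> x * ln x.
Proof.
rewrite le_eqVlt => /predU1P[<-|x0] gx; last first.
  by apply: cvgM => //; apply: (continuous_cvg _ _ gx); exact: continuous_ln.
rewrite mul0r; apply: norm_cvg0.
apply: (@squeeze_cvgr _ _ _ _ (fun=> 0) (fun t => 2 * Num.sqrt (g t))).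
- near=> t; rewrite normr_ge0 xlnx_le_sqrt //.
  by near: t; move/cvgr_le: gx; apply; exact: ltr01.
- exact: cvg_cst.
- rewrite -[X in _ --> X](mulr0 2) -[X in _ * X]sqrtr0; apply: cvgMr.
  by apply: (continuous_cvg _ _ gx); exact: sqrt_continuous.
Unshelve. all: by end_near. Qed.

Lemma cvg_exprn (T : Type) (F : set_system T) {FF : Filter F} (g : T -> R) (x : R) m :
  g @ F --> x -> (fun t => g t ^+ m) @ F --> x ^+ m.
Proof.
move=> gx; elim: m => [|m IH]; first exact: cvg_cst.
by rewrite exprS; under eq_fun do rewrite exprS; exact: cvgM.
Qed.

End XLnX.

Section Continuity.
Variables (R : realType) (d : nat) (theta : 'I_d.+1 -> {fset word d}).
Hypothesis Htheta : is_subst theta.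
Variable P0 : 'rV[R]_(nparams theta).
Hypothesis HP0 : nondegenerate_data P0.
Implicit Types (P : 'rV[R]_(nparams theta)) (u v w : word d) (n m k : nat) (a c : 'I_d.+1).

Local Notation D := (nondegenerate_data (R := R) (theta := theta)).
Local Notation F := (within D (nbhs P0)).

Lemma param_cvg a (s : theta a) : (fun P => param P s) @ F --> param P0 s.
Proof.
apply: cvg_within_filter; rewrite /param.
under eq_fun do rewrite mxE; rewrite mxE; exact: coord_continuous.
Qed.

(** Expectations are polynomials in the probabilities. *)
Lemma step_expect_cvg u (f : 'rV[R]_(nparams theta) -> word d -> R) (f0 : word d -> R) :
  (forall w, (fun P => f P w) @ F --> f0 w) ->
  (fun P => step_expect P u (f P)) @ F --> step_expect P0 u f0.
Proof.
elim: u f f0 => [|a u IH] f f0 ff0 /=; first exact: ff0.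
apply: cvg_sum_seq => s _; apply: cvgM; first exact: param_cvg.
exact: (IH (fun P v => f P (val s ++ v))).
Qed.

Lemma expect_cvg n u (f : 'rV[R]_(nparams theta) -> word d -> R) (f0 : word d -> R) :
  (forall w, (fun P => f P w) @ F --> f0 w) ->
  (fun P => expect P n u (f P)) @ F --> expect P0 n u f0.
Proof.
elim: n f f0 => [|n IH] f f0 ff0 /=; first exact: ff0.
by apply: IH => w; exact: step_expect_cvg.
Qed.

Lemma entropy_of_iterate_cvg m c :
  (fun P => entropy_of_iterate P m c) @ F --> entropy_of_iterate P0 m c.
Proof.
pose H P := \sum_(w <- words_upto d (maxlen theta ^ m * size [:: c]))
   - (pr P m [:: c] w * ln (pr P m [:: c] w)).
have HE P : nondegenerate_data P -> entropy_of_iterate P m c = H P.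
  move=> HP; rewrite /entropy_of_iterate (expect_sum_pr Htheta HP _ (leqnn _)).
  by apply: eq_bigr => w _; rewrite mulrN.
rewrite HE //; apply: (@cvg_trans _ (H @ F)).
  by apply: near_eq_cvg; near=> P; rewrite HE //; near: P; exact: withinT.
apply: cvg_sum_seq => w _; apply: cvgN; apply: cvg_xlnx.
  exact: (pr_ge0 Htheta HP0).
by apply: expect_cvg => v; exact: cvg_cst.
Unshelve. all: by end_near. Qed.

Variable phi : 'rV[R]_(nparams theta) -> word d -> R.
Hypothesis Hphi : forall P, nondegenerate_data P -> word_frequencies P (phi P).

(** Letter frequencies are trapped between the extreme values, over the starting
    letter, of the frequencies in a finite iterate; those are continuous in P and
    agree in the limit. *)
Lemma letter_freq_cvg c : (fun P => phi P [:: c]) @ F --> phi P0 [:: c].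
Proof.
pose f i : R := (i == c)%:R.
have fE P : letter_mean (phi P) f = phi P [:: c].
  rewrite /letter_mean (bigD1 c) //= /f eqxx mulr1 big1 ?addr0 // => i /negbTE ->.
  by rewrite mulr0.
under eq_fun do rewrite -fE; rewrite -fE.
pose freq k a P := expect P k [:: a] (letter_sum f) / expect P k [:: a] (@len R d).
have freq_cvg k a : freq k a @ F --> freq k a P0.
  apply: cvgM; first by apply: expect_cvg => w; exact: cvg_cst.
  apply: cvgV; first by rewrite gt_eqF ?(expect_len_gt0 Htheta HP0).
  by apply: expect_cvg => w; exact: cvg_cst.
apply/cvgrPdist_le => eps eps0; have eps20 : 0 < eps / 2 by rewrite divr_gt0.
have [k freq_k] : exists k, forall a, `|letter_mean (phi P0) f - freq k a P0| <= eps / 2.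
  suff : \forall k \near \oo, forall a, `|letter_mean (phi P0) f - freq k a P0| <= eps / 2.
    by move=> H; near \oo => k; exists k => a; move: a; near: k.
  apply: filter_forall => a.
  by have /cvgrPdist_le := letter_mean_cvg (Hphi HP0) (f := f) a; apply.
near=> P.
have HP : nondegenerate_data P by near: P; exact: withinT.
have {}freq_k a : `|letter_mean (phi P0) f - freq k a P| <= eps.
  rewrite [eps]splitr (le_trans (ler_distD (freq k a P0) _ _)) // lerD //.
  move: a; near: P; apply: filter_forall => a.
  by have /cvgrPdist_le := freq_cvg k a; apply.
have freq_le a : (letter_mean (phi P0) f - eps) * expect P k [:: a] (@len R d) <=
    expect P k [:: a] (letter_sum f) <=
    (letter_mean (phi P0) f + eps) * expect P k [:: a] (@len R d).
  have N0 := expect_len_gt0 Htheta HP k a.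
  have := freq_k a; rewrite ler_distlC /freq => /andP[lo hi].
  by move: lo hi; rewrite ler_pdivlMr // ler_pdivrMr // => -> ->.
have lamk0 : 0 < growth_rate P (phi P) ^+ k.
  by rewrite exprn_gt0 // (growth_rate_gt0 Htheta HP (Hphi HP)).
have lb := ler_letter_mean Htheta HP (Hphi HP) (fun a => (andP (freq_le a)).1).
have ub := ler_letter_mean Htheta HP (Hphi HP) (fun a => (andP (freq_le a)).2).
move: lb ub; rewrite !letter_meanZ (letter_mean_len Htheta HP (Hphi HP)).
rewrite (letter_mean_expect Htheta HP (Hphi HP)) !(mulrC _ (_ ^+ k)) !ler_pM2l //.
by rewrite ler_distlC => -> ->.
Unshelve. all: by end_near. Qed.

Lemma growth_rate_cvg :
  (fun P => growth_rate P (phi P)) @ F --> growth_rate P0 (phi P0).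
Proof.
apply: cvg_sum_seq => c _; apply: cvgM; first exact: letter_freq_cvg.
by apply: expect_cvg => w; exact: cvg_cst.
Qed.

Lemma mean_entropy_cvg m :
  (fun P => mean_entropy P m (phi P)) @ F --> mean_entropy P0 m (phi P0).
Proof.
apply: cvgM.
  apply: cvg_sum_seq => c _; apply: cvgM; first exact: letter_freq_cvg.
  exact: entropy_of_iterate_cvg.
apply: cvgV; last by apply: cvg_exprn; exact: growth_rate_cvg.
by rewrite expf_neq0 // gt_eqF // (growth_rate_gt0 Htheta HP0 (Hphi HP0)).
Qed.

End Continuity.

(** * Continuity of the entropy *)

Theorem corollary3p7 (R : realType) (d : nat)
  (theta : 'I_d.+1 -> {fset word d})
  (Htheta : is_subst theta)
  (Hprim : exists P : 'rV[R]_(nparams theta),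
      nondegenerate_data P /\ primitive_subst P)
  (mu : 'rV[R]_(nparams theta) -> probability (full_shift d) R)
  (Hmu : forall P, nondegenerate_data P -> is_frequency_measure P (mu P)) :
  {within nondegenerate_data (theta := theta),
     continuous (fun P : 'rV[R]_(nparams theta) => entropy P (mu P))}.
Proof.
pose phi P := frequency_of P (mu P).
have Hphi P (HP : nondegenerate_data P) : word_frequencies P (phi P).
  exact: (frequency_ofP Htheta HP (Hmu P HP)).
pose lam P := growth_rate P (phi P); pose L P m := mean_entropy P m (phi P).
pose kappa m : R := ln d.+1%:R + m%:R * ln (maxlen theta)%:R.
have lam_gt1 P (HP : nondegenerate_data P) : 1 < lam P.
  have [P1 [HP1 prim]] := Hprim.
  exact: (growth_rate_gt1 Htheta HP1 prim HP (Hphi P HP)).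
have ent P (HP : nondegenerate_data P) : [/\ L P m @[m --> \oo] --> entropy P (mu P),
    forall m, entropy P (mu P) <= L P m + ln d.+1%:R / lam P ^+ m &
    forall m, lam P * L P m.+1 - L P m - kappa m.+1 / lam P ^+ m <=
      (lam P - 1) * entropy P (mu P)].
  have [h [bh Lh h_le]] := entropy_limit Htheta HP (Hphi P HP) (lam_gt1 P HP).
  rewrite (entropyE bh); split => // m.
  exact: (entropy_limit_ge Htheta HP (Hphi P HP) (lam_gt1 P HP) m Lh).
apply/subspace_continuousP => P0 HP0.
have [L_cvg0 _ _] := ent P0 HP0; set h0 := entropy P0 (mu P0) in L_cvg0 *.
have lam0 := lam_gt1 P0 HP0.
pose ub m P := L P m + ln d.+1%:R / lam P ^+ m.
pose lb m P := (lam P * L P m.+1 - L P m - kappa m.+1 / lam P ^+ m) / (lam P - 1).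
(* The functions ub m and lb m are continuous at P0, enclose the entropy near P0 and
   converge to it at P0. *)
have ub_cvg0 : (fun m => ub m P0) @ \oo --> h0.
  rewrite -[h0]addr0; apply: cvgD => //; exact: cst_geometric_cvg0.
have lb_cvg0 : (fun m => lb m P0) @ \oo --> h0.
  have -> : h0 = (lam P0 * h0 - h0 - 0) / (lam P0 - 1).
    by field; rewrite subr_eq0 gt_eqF.
  apply: cvgMl; apply: cvgB; last first.
    have kappaS m : kappa m.+1 =
        (ln d.+1%:R + ln (maxlen theta)%:R) + m%:R * ln (maxlen theta)%:R.
      by rewrite /kappa -[m.+1%:R]natr1 mulrDl mul1r [X in _ + X]addrC addrA.
    under eq_fun do rewrite kappaS.
    exact: linear_geometric_cvg0.
  apply: cvgB => //; apply: cvgMr.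
  by move: (L_cvg0); rewrite -(cvg_shiftS _ _).
have lam_cvg : lam P @[P --> within (@nondegenerate_data R d theta) (nbhs P0)] --> lam P0.
  exact: growth_rate_cvg.
have L_cvg m : L P m @[P --> within (@nondegenerate_data R d theta) (nbhs P0)] --> L P0 m.
  exact: mean_entropy_cvg.
have lam_exp_cvg (x : R) m :
    x / lam P ^+ m @[P --> within (@nondegenerate_data R d theta) (nbhs P0)] --> x / lam P0 ^+ m.
  apply: cvgMr; apply: cvgV; last exact: cvg_exprn.
  by rewrite gt_eqF // lam_exp_gt0.
have ub_cvg m : ub m P @[P --> within (@nondegenerate_data R d theta) (nbhs P0)] --> ub m P0.
  by apply: cvgD.
have lb_cvg m : lb m P @[P --> within (@nondegenerate_data R d theta) (nbhs P0)] --> lb m P0.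
  apply: cvgM.
    by apply: cvgB => //; apply: cvgB => //; exact: cvgM.
  apply: cvgV; first by rewrite subr_eq0 gt_eqF.
  by apply: cvgB => //; exact: cvg_cst.
suff : entropy P (mu P) @[P --> within (@nondegenerate_data R d theta) (nbhs P0)] --> h0 by [].
apply/cvgrPdist_le => eps eps0; have eps20 : 0 < eps / 2 by rewrite divr_gt0.
have [m /andP[ub0 lb0]] : exists m, (ub m P0 <= h0 + eps / 2) && (h0 - eps / 2 <= lb m P0).
  near \oo => m; exists m; apply/andP; split; near: m.
    by move/cvgr_le: ub_cvg0; apply; rewrite ltrDl.
  by move/cvgr_ge: lb_cvg0; apply; rewrite ltrBlDr ltrDl.
near=> P.
have HP : nondegenerate_data P by near: P; exact: withinT.
have [_ h_ub h_lb] := ent P HP.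
have ubP : ub m P <= ub m P0 + eps / 2.
  by near: P; move/cvgr_le: (ub_cvg m); apply; rewrite ltrDl.
have lbP : lb m P0 - eps / 2 <= lb m P.
  by near: P; move/cvgr_ge: (lb_cvg m); apply; rewrite ltrBlDr ltrDl.
have {}h_ub : entropy P (mu P) <= ub m P by exact: h_ub.
have {}h_lb : lb m P <= entropy P (mu P).
  by rewrite ler_pdivrMr ?subr_gt0 ?lam_gt1 // [leRHS]mulrC; exact: h_lb.
rewrite ler_distlC; apply/andP; split; lra.
Unshelve. all: by end_near. Qed.
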